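(* Let $n\ge3$, $1\le k\le n/2$, and let $F_1,F_2$ be Minkowski norms on $\mathbb{R}^n$ invariant under the standard block diagonal action of $SO(k)\times SO(n-k)$. Let $\Phi$ be a local Hessian isometry from $F_1$ to $F_2$ defined on a connected $SO(k)\times SO(n-k)$-invariant conic open set $C$ disjoint from $V'=\mathrm{span}(e_1,\dots,e_k)$ (and, if $k>1$, also from $V''=\mathrm{span}(e_{k+1},\dots,e_n)$), with image disjoint from the same set(s), and mapping orbits into orbits. Then $\Phi=\Phi_1\circ\Phi_2$, where $\Phi_1$ is an invertible linear map of $\mathbb{R}^n$ (a linear isometry from some Minkowski norm $F_3=F_2\circ\Phi_1$ to $F_2$) and $\Phi_2$ is a local Hessian isometry from $F_1$ to $F_3$ on $C$ which in spherical coordinates has the form $(r,t,\xi)\mapsto(\rho(r,t),\theta(t),\xi)$ if $k=1$, resp. $(r,t,\xi',\xi'')\mapsto(\rho(r,t),\theta(t),\xi',\xi'')$ if $k>1$ (i.e. it fixes all $\xi$-, resp. $\xi'$- and $\xi''$-coordinates); in particular $\Phi_2$ is equivariant with respect to $O(n-1)$ (if $k=1$), resp. $O(k)\times O(n-k)$ (if $k>1$).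
   Context: A Minkowski norm on $\mathbb{R}^n$ is a continuous function $F:\mathbb{R}^n\to\mathbb{R}_{\ge 0}$, smooth and positive on $\mathbb{R}^n\setminus\{0\}$, positively $1$-homogeneous, such that the Hessian of $E=\tfrac12F^2$ is positive definite on $\mathbb{R}^n\setminus\{0\}$; its Hessian metric is $g=\mathrm{d}^2E$. The standard block diagonal action is by $\mathrm{diag}(A',A'')$, $A'\in SO(k)$, $A''\in SO(n-k)$; for $k=1$, $O(n-1)$ acts by $\mathrm{diag}(1,A)$, and for $k>1$, $O(k)\times O(n-k)$ acts by $\mathrm{diag}(A',A'')$. Spherical coordinates: for $k=1$, $(r,\theta,\xi)$ with $x_1=r\cos\theta$, $(x_2,\dots,x_n)^T=r\sin\theta\,\xi$, $\theta\in(0,\pi)$, $\xi$ in the unit sphere of $\mathbb{R}^{n-1}$; for $k>1$, $(r,\theta,\xi',\xi'')$ with $(x_1,\dots,x_k)^T=r\cos\theta\,\xi'$, $(x_{k+1},\dots,x_n)^T=r\sin\theta\,\xi''$, $\theta\in(0,\pi/2)$, $\xi',\xi''$ in the unit spheres of $\mathbb{R}^k,\mathbb{R}^{n-k}$; $t$ denotes the $\theta$-coordinate on the domain side. A conic set is one of the form $\{\lambda y\mid y\in U,\lambda>0\}$. A local Hessian isometry is a positively $1$-homogeneous diffeomorphism between conic open sets pulling back one Hessian metric to the other. *)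

(* Defs.v *)
(* R^n is modelled as row vectors
   'rV[R]_(k + m) with n = k + m, so that the block splitting x = (x', x'')
   with x' in R^k, x'' in R^(n-k) is row_mx (lsubmx x) (rsubmx x). *)
From HB Require Import structures.
From mathcomp Require Import all_boot all_order all_algebra.
From mathcomp Require Import all_classical all_reals all_analysis.
Set Implicit Arguments. Unset Strict Implicit. Unset Printing Implicit Defensive.
Import Order.TTheory GRing.Theory Num.Theory.
Import numFieldNormedType.Exports.
Local Open Scope classical_set_scope.
Local Open Scope ring_scope.

Section Defs.
Variable R : realType.

Section Smooth.
Variables (V W : normedModType R).

Fixpoint iderive (f : V -> W) (vs : seq V) : V -> W :=
  match vs with
  | [::] => f
  | v :: vs' => fun x => derive (iderive f vs') x v
  end.

Definition smooth_on (U : set V) (f : V -> W) : Prop :=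
  forall vs : seq V, forall x, U x ->
    {for x, continuous (iderive f vs)} /\ (forall v, derivable (iderive f vs) x v).

End Smooth.

Definition diffeo_on (V : normedModType R) (U : set V) (f : V -> V) : Prop :=
  smooth_on (W:=V) U f /\
  exists g : V -> V, smooth_on (W:=V) (f @` U) g /\
    (forall x, U x -> g (f x) = x) /\ (forall y, (f @` U) y -> f (g y) = y).

Section Rn.
Variables k m : nat.
Local Notation V := 'rV[R]_(k + m).

Definition enorm n (x : 'rV[R]_n) : R := Num.sqrt (\sum_i (x 0 i) ^+ 2).

Definition energy (F : V -> R) : V -> R := fun x => (F x) ^+ 2 / 2.
Definition hess_metric (F : V -> R) (x u v : V) : R :=
  derive (fun y => derive (energy F) y v) x u.

Definition minkowski_norm (F : V -> R) : Prop :=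
  continuous F /\
  (forall x, 0 <= F x) /\
  smooth_on (~` [set 0]) F /\
  (forall x, x != 0 -> 0 < F x) /\
  (forall (l : R) x, 0 < l -> F (l *: x) = l * F x) /\
  (forall x v, x != 0 -> v != 0 -> 0 < hess_metric F x v v).

Definition conic (C : set V) : Prop :=
  forall (l : R) x, 0 < l -> C x -> C (l *: x).

Definition local_hessian_isometry (F1 F2 : V -> R) (C : set V) (Phi : V -> V)
  : Prop :=
  open C /\ conic C /\ open (Phi @` C) /\ conic (Phi @` C) /\
  (forall (l : R) x, 0 < l -> C x -> Phi (l *: x) = l *: Phi x) /\
  diffeo_on C Phi /\
  (forall x u v, C x ->
     hess_metric F2 (Phi x) (derive Phi x u) (derive Phi x v)
     = hess_metric F1 x u v).

Definition SOmx p (A : 'M[R]_p) : Prop := A *m A^T = 1%:M /\ \det A = 1.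
Definition block_SO (g : 'M[R]_(k + m)) : Prop :=
  exists (A : 'M[R]_k) (B : 'M[R]_m), SOmx A /\ SOmx B /\ g = block_mx A 0 0 B.
Definition G_invariant_fun (F : V -> R) : Prop :=
  forall g x, block_SO g -> F (x *m g) = F x.
Definition G_invariant_set (C : set V) : Prop :=
  forall g x, block_SO g -> C x -> C (x *m g).
Definition maps_orbits_into_orbits (C : set V) (Phi : V -> V) : Prop :=
  forall g x, block_SO g -> C x ->
    exists h, block_SO h /\ Phi (x *m g) = Phi x *m h.

Definition Vprime : set V := [set x | rsubmx x = 0].
Definition Vsecond : set V := [set x | lsubmx x = 0].

Definition sph_t (x : V) : R :=
  if k == 1%N then acos ((\sum_i lsubmx x 0 i) / enorm x) (* = acos (x_1/r) as k = 1 *)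
  else acos (enorm (lsubmx x) / enorm x).

(* Phi2 has, in spherical coordinates, the form
   (r,t,xi) |-> (rho(r,t), theta(t), xi)          if k = 1
   (r,t,xi',xi'') |-> (rho(r,t), theta(t), xi', xi'')  if k > 1 *)
Definition spherical_form (C : set V) (Phi2 : V -> V) : Prop :=
  exists (rho : R -> R -> R) (theta : R -> R),
    forall x, C x ->
      let r := enorm x in let t := sph_t x in
      0 < rho r t /\
      (if k == 1%N then 0 < theta t < pi else 0 < theta t < pi / 2) /\
      Phi2 x = rho r t *: row_mx
        (if k == 1%N then cos (theta t) *: const_mx 1
         else (cos (theta t) / enorm (lsubmx x)) *: lsubmx x)
        ((sin (theta t) / enorm (rsubmx x)) *: rsubmx x).
End Rn.
End Defs.

(* Main.v *)
(* On the orbit of x = (x', x'') the Hessian metric of an invariant norm restricts to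
   alpha <u', w'> + beta <u'', w''> with alpha and beta constant, and the vectors orthogonal to the
   orbit are those whose two components are radial. The Koszul identity then shows that Phi sends
   great circles in the two factors to curves whose acceleration is radial in each factor, that is,
   to great circles again. On a flat torus through x the angular speeds transform by an integer
   matrix, which is unimodular because Phi is injective and has orthogonal columns because Phi is
   isometric; hence it is monomial, and on one orbit Phi preserves or exchanges the two factors,
   acting on each as a similarity. Since the derivative of Phi along (x', 0) is radial in each
   factor, the directions of the two components of Phi do not change along a meridian, so the
   orthogonal factor P found on one orbit serves on the whole connected domain. *)
Require Import Defs.
From HB Require Import structures.
From mathcomp Require Import all_boot all_order all_algebra.
From mathcomp Require Import all_classical all_reals all_analysis.
From mathcomp Require Import ring lra zify.
Set Implicit Arguments. Unset Strict Implicit. Unset Printing Implicit Defensive.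
Import Order.TTheory GRing.Theory Num.Theory.
Import numFieldNormedType.Exports.
Local Open Scope classical_set_scope.
Local Open Scope ring_scope.

(** * Calculus of vector-valued maps *)

Section DirectionalDerivatives.
Context {R : realType} {V W : normedModType R}.
Implicit Types (f : V -> W) (x v : V).

Lemma is_derive_line f x v (t : R) : derivable f (x + t *: v) v ->
  is_derive t 1 (fun s => f (x + s *: v)) ('D_v f (x + t *: v)).
Proof.
set q := fun h : R => h^-1 *: (((fun s : R => f (x + s *: v)) \o shift t) (h *: 1)
  - f (x + t *: v)).
have qE : q = fun h : R => h^-1 *: ((f \o shift (x + t *: v)) (h *: v) - f (x + t *: v)).
  apply/funext => h; rewrite /q /=; congr (_ *: (f _ - _)).
  by rewrite scalerDl addrCA [_%:A]mulr1.
by move=> df; split; rewrite /derivable /derive -/q qE.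
Qed.

Lemma is_derive_translate f x v a df : is_derive (x + a) v f df ->
  is_derive x v (fun y => f (y + a)) df.
Proof.
set q := fun h : R => h^-1 *: (((fun y => f (y + a)) \o shift x) (h *: v) - f (x + a)).
have qE : q = fun h : R => h^-1 *: ((f \o shift (x + a)) (h *: v) - f (x + a)).
  by apply/funext => h; rewrite /q /= addrA.
by move=> [dfx <-]; split; [move: dfx|]; rewrite /derivable /derive -/q qE.
Qed.

Lemma is_derive_comp_linear (W' : normedModType R) (L : {linear W -> W'}) f x v df :
  continuous L -> is_derive x v f df -> is_derive x v (L \o f) (L df).
Proof.
move=> cL [dfx <-].
pose q (h : R) := h^-1 *: ((f \o shift x) (h *: v) - f x).
have Lq : L (q h) @[h --> 0^'] --> L ('D_v f x) := cvg_comp _ _ dfx (cL _).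
have qE : (fun h : R => h^-1 *: ((L \o f \o shift x) (h *: v) - (L \o f) x)) = L \o q.
  by apply/funext => h; rewrite /q /= linearZZ (linearB L).
split; rewrite /derivable /derive qE; first by apply/cvg_ex; exists (L ('D_v f x)).
by apply: cvg_lim Lq.
Qed.

Lemma near_eq_continuous (T U : topologicalType) (f g : T -> U) (x : T) :
  {near x, f =1 g} -> {for x, continuous f} -> {for x, continuous g}.
Proof.
move=> fg cf; rewrite /prop_for /continuous_at -(nbhs_singleton fg).
exact: cvg_trans (near_eq_cvg fg) cf.
Qed.

Lemma is_derive_comp_differentiable (f : V -> W) (g : R -> V) (t : R) dg :
  is_derive t 1 g dg -> differentiable f (g t) -> is_derive t 1 (f \o g) ('D_dg f (g t)).
Proof.
move=> [/derivable1_diffP dg_t <-] df.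
have dfg : differentiable (f \o g) t by apply: differentiable_comp.
split; first exact: diff_derivable.
by rewrite deriveE// diff_comp//= [in RHS]deriveE// [in RHS]deriveE.
Qed.

End DirectionalDerivatives.

Section MatrixValued.
Context {R : realType} {V : normedModType R}.

Lemma is_derive_mxP m n (M : V -> 'M[R]_(m, n)) x v dM :
  is_derive x v M dM <-> forall i j, is_derive x v (fun y => M y i j) (dM i j).
Proof.
split=> [[d <-] i j|h].
  by split; [exact: (derivable_mxP _ _ _).1|rewrite derive_mx// mxE].
have d : derivable M x v by apply/derivable_mxP => i j; have [] := h i j.
by split=> //; apply/matrixP => i j; rewrite derive_mx// mxE; have [] := h i j.
Qed.

Lemma differentiable_mxP m n (M : V -> 'M[R]_(m, n)) x :
  differentiable M x <-> forall i j, differentiable (fun y => M y i j) x.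
Proof.
split=> [d i j|d].
  exact: differentiable_comp d (differentiable_coord (M x) i j).
have -> : M = \sum_(i < m) \sum_(j < n) (fun y => M y i j *: delta_mx i j).
  apply/funext => y; rewrite {1}[M y]matrix_sum_delta fct_sumE.
  by apply: eq_bigr => i _; rewrite fct_sumE.
by do 2 apply: differentiable_sum => ?; apply: differentiableZl.
Qed.

Lemma differentiable_mulmx m n p (f : V -> 'M[R]_(m, n)) (g : V -> 'M[R]_(n, p)) x :
  differentiable f x -> differentiable g x -> differentiable (fun y => f y *m g y) x.
Proof.
move=> /differentiable_mxP df /differentiable_mxP dg; apply/differentiable_mxP => i j.
have -> : (fun y => (f y *m g y) i j) =
    \sum_(l < n) ((fun y => f y i l) * (fun y => g y l j)).
  by apply/funext => y; rewrite mxE fct_sumE.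
by apply: differentiable_sum => l; apply: differentiableM.
Qed.

Lemma is_derive_mulmx m n p (f : V -> 'M[R]_(m, n)) (g : V -> 'M[R]_(n, p)) x v df dg :
  is_derive x v f df -> is_derive x v g dg ->
  is_derive x v (fun y => f y *m g y) (df *m g x + f x *m dg).
Proof.
move=> /is_derive_mxP hf /is_derive_mxP hg; apply/is_derive_mxP => i j.
have -> : (fun y => (f y *m g y) i j) =
    \sum_(l < n) ((fun y => f y i l) * (fun y => g y l j)).
  by apply/funext => y; rewrite mxE fct_sumE.
apply: (is_derive_eq (is_derive_sum (fun l => is_deriveM (hf i l) (hg l j)))).
rewrite !mxE -big_split; apply: eq_bigr => l _.
by rewrite /GRing.scale /= addrC [df i l * _]mulrC.
Qed.

Lemma is_derive_row_mx m n p (f : V -> 'M[R]_(m, n)) (g : V -> 'M[R]_(m, p)) x v df dg :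
  is_derive x v f df -> is_derive x v g dg ->
  is_derive x v (fun y => row_mx (f y) (g y)) (row_mx df dg).
Proof.
move=> /is_derive_mxP hf /is_derive_mxP hg; apply/is_derive_mxP => i j.
case: (split_ordP j) => l ->; [rewrite row_mxEl|rewrite row_mxEr];
  by under eq_fun do rewrite ?row_mxEl ?row_mxEr.
Qed.

Lemma is_derive_lsubmx m n p (f : V -> 'M[R]_(m, n + p)) x v df :
  is_derive x v f df -> is_derive x v (fun y => lsubmx (f y)) (lsubmx df).
Proof. exact: (is_derive_comp_linear (L := lsubmx) (@continuous_lsubmx R m n p)). Qed.

Lemma is_derive_rsubmx m n p (f : V -> 'M[R]_(m, n + p)) x v df :
  is_derive x v f df -> is_derive x v (fun y => rsubmx (f y)) (rsubmx df).
Proof. exact: (is_derive_comp_linear (L := rsubmx) (@continuous_rsubmx R m n p)). Qed.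

End MatrixValued.

Lemma mulmxr_continuous {R : realType} m n p (Q : 'M[R]_(n, p)) :
  continuous (fun M : 'M[R]_(m, n) => M *m Q).
Proof.
by move=> M; apply: differentiable_continuous; apply: differentiable_mulmx.
Qed.

Lemma is_derive_mulmxr {R : realType} {V : normedModType R} m n p
    (f : V -> 'M[R]_(m, n)) (Q : 'M[R]_(n, p)) x v df :
  is_derive x v f df -> is_derive x v (fun y => f y *m Q) (df *m Q).
Proof.
exact: (is_derive_comp_linear (L := mulmxr Q) (@mulmxr_continuous R m n p Q)).
Qed.

Lemma is_derive_0_segment {R : realType} m n (f : R -> 'M[R]_(m, n)) (a b : R) : a <= b ->
  (forall s : R, a <= s <= b -> is_derive s 1 f 0) -> f a = f b.
Proof.
move=> ab df; apply/matrixP => i j; pose g (s : R) := f s i j.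
have dg (s : R) : a <= s <= b -> is_derive s 1 g 0.
  by move=> /df/is_derive_mxP/(_ i j); rewrite mxE.
have cg : {within `[a, b], continuous g}.
  by apply: derivable_within_continuous => s; rewrite in_itv /= => /dg[].
have dg_int (s : R) : s \in `]a, b[ -> is_derive s 1 g ((cst 0 : R -> R) s).
  by rewrite in_itv /= => /andP[/ltW a_s /ltW s_b]; apply: dg; rewrite a_s.
by have [s _] := MVT_segment ab dg_int cg; rewrite /= mul0r => /subr0_eq.
Qed.

Definition coordmx {R : realType} m n (i : 'I_m) (j : 'I_n) (M : 'M[R]_(m, n)) : R := M i j.

Fact coordmx_is_linear {R : realType} m n i j : linear (@coordmx R m n i j).
Proof. by move=> a A B; rewrite /coordmx !mxE. Qed.

HB.instance Definition _ {R : realType} m n i j :=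
  GRing.isLinear.Build R 'M[R]_(m, n) R *%R (coordmx i j) (coordmx_is_linear i j).

Lemma coordmx_continuous {R : realType} m n i j : continuous (@coordmx R m n i j).
Proof. exact: coord_continuous. Qed.

Section PartialDerivatives.
Context {R : realType} {V : normedModType R}.
Implicit Types (f : V -> R) (x u v : V).

Lemma MVT_line f x v (h : R) :
  (forall s : R, 0 <= s <= 1 -> derivable f (x + (s * h) *: v) v) ->
  exists2 s : R, 0 <= s <= 1 & f (x + h *: v) - f x = h * 'D_v f (x + (s * h) *: v).
Proof.
move=> df; pose g (s : R) := f (x + (s * h) *: v).
have dg (s : R) : 0 <= s <= 1 -> is_derive s 1 g ('D_v f (x + (s * h) *: v) * h).
  move=> /df dfs; apply: (is_derive1_comp (f := fun t => f (x + t *: v)) (g := *%R^~ h)).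
    exact: is_derive_line.
  rewrite (_ : *%R^~ h = id * cst h :> (R -> R))//.
  by apply: is_derive_eq; rewrite /= scaler0 add0r [_%:A]mulr1.
have dgo (s : R) : s \in `]0, 1[%R -> is_derive s 1 g ('D_v f (x + (s * h) *: v) * h).
  by rewrite in_itv /= => /andP[s0 s1]; apply: dg; rewrite !ltW.
have cg : {within `[0, 1], continuous g}.
  apply: derivable_within_continuous => s; rewrite in_itv /= => /dg gs.
  exact: ex_derive.
have [s] := MVT_segment ler01 dgo cg; rewrite in_itv /= => s01.
by rewrite /g mul1r mul0r scale0r addr0 subr0 mulr1 mulrC => fxh; exists s.
Qed.

Lemma near_segment (P : V -> Prop) x v : (\forall y \near x, P y) ->
  \forall z \near x & h \near (0 : R), forall s : R, 0 <= s <= 1 -> P (z + (s * h) *: v).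
Proof.
move=> /nbhs_ballP[d /= d0 Pd]; near=> z h => s /andP[s0 s1].
apply: Pd; rewrite -ball_normE /= opprD addrA.
rewrite (le_lt_trans (ler_normB _ _))// [d]splitr ltrD//.
  by near: z; apply: cvgr_dist_lt; rewrite ?divr_gt0//; exact: cvg_id.
rewrite -scalerA normrZ ger0_norm//; apply: le_lt_trans (_ : `|h *: v| < _).
  by rewrite ler_piMl.
near: h; have h0 : h *: v @[h --> 0] --> (0 : V).
  by rewrite -[X in _ --> X](scale0r v); exact: scalel_continuous.
by apply: (cvgr0_norm_lt _ h0); rewrite divr_gt0.
Unshelve. all: by end_near. Qed.

Lemma strict_derivative f x v : (\forall y \near x, derivable f y v) ->
  {for x, continuous ('D_v f)} -> forall e, 0 < e ->
  \forall z \near x & h \near (0 : R),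
    `|f (z + h *: v) - f z - h * 'D_v f x| <= e * `|h|.
Proof.
move=> df cf e e0.
have near_x : \forall y \near x, derivable f y v /\ `|'D_v f x - 'D_v f y| < e.
  by apply: filterI => //; move/cvgrPdist_lt: cf; apply.
move: (near_segment v near_x); apply: filterS => -[z h] /= seg.
have [s s01 ->] := MVT_line (fun s s01 => (seg s s01).1).
rewrite -mulrBr normrM mulrC ler_wpM2r// distrC ltW//.
by have [] := seg s s01.
Qed.

Lemma second_difference_cvg f x u v :
  (\forall y \near x, derivable f y u) -> (\forall y \near x, derivable ('D_u f) y v) ->
  {for x, continuous ('D_v ('D_u f))} ->
  h ^- 2 * (f (x + h *: u + h *: v) - f (x + h *: u) - f (x + h *: v) + f x)
    @[h --> 0^'] --> 'D_v ('D_u f) x.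
Proof.
move=> df ddf cdf; apply/cvgrPdist_le => e e0.
have step : \forall z \near x & h \near (0 : R), [/\ derivable f z u,
    derivable f (z + h *: v) u &
    `|'D_u f (z + h *: v) - 'D_u f z - h * 'D_v ('D_u f) x| <= e * `|h|].
  move: (near_segment v df) (strict_derivative ddf cdf e0); apply: filterS2.
  move=> [z h] /= seg est; split=> //.
    by have := seg 0; rewrite mul0r scale0r addr0; apply; rewrite lexx ler01.
  by have := seg 1; rewrite mul1r; apply; rewrite lexx ler01.
have [[A B] /= [nA nB] AB] := step.
have near0 : \forall h \near (0 : R), B h /\ forall s : R, 0 <= s <= 1 -> A (x + (s * h) *: u).
  apply: filterI => //; have [[A' B'] /= [nA' nB'] seg] := near_segment u nA.
  apply: filterS nB' => h B'h s s01.
  by apply: (seg (x, h)) => //=; split=> //; exact: nbhs_singleton.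
near=> h.
have h0 : h != 0 by near: h; exact: nbhs_dnbhs_neq.
have [Bh Ah] : B h /\ forall s : R, 0 <= s <= 1 -> A (x + (s * h) *: u).
  by near: h; exact: cvg_within near0.
pose g y := f (y + h *: v) - f y.
have dg (s : R) : 0 <= s <= 1 -> let z := x + (s * h) *: u in
    is_derive z u g ('D_u f (z + h *: v) - 'D_u f z).
  move=> s01 z; have [dz dzh _] := AB (z, h) (conj (Ah s s01) Bh).
  by apply: is_deriveB; [apply: is_derive_translate|]; exact: derivableP.
have [s s01 gxh] := MVT_line (fun s s01 => @ex_derive _ _ _ _ _ _ _ (dg s s01)).
have -> : f (x + h *: u + h *: v) - f (x + h *: u) - f (x + h *: v) + f x =
    g (x + h *: u) - g x by rewrite /g; ring.
rewrite gxh (@derive_val _ _ _ _ _ _ _ (dg s s01)).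
have [_ _] := AB (x + (s * h) *: u, h) (conj (Ah s s01) Bh).
rewrite /=; set D := 'D_v ('D_u f) x; set d := 'D_u f _ - _ => est.
have -> : D - h ^- 2 * (h * d) = - (h^-1 * (d - h * D)) by field.
by rewrite normrN normrM normfV mulrC ler_pdivrMr ?normr_gt0.
Unshelve. all: by end_near. Qed.

Lemma schwarz f x u v :
  (forall w, \forall y \near x, derivable f y w) ->
  (forall w w', \forall y \near x, derivable ('D_w f) y w') ->
  (forall w w', {for x, continuous ('D_w' ('D_w f))}) ->
  'D_u ('D_v f) x = 'D_v ('D_u f) x.
Proof.
move=> df ddf cdf.
have cvu := second_difference_cvg (df v) (ddf v u) (cdf v u).
have cuv := second_difference_cvg (df u) (ddf u v) (cdf u v).
rewrite -(cvg_lim _ cvu)// -(cvg_lim _ cuv)//; congr (lim (_ @ 0^')).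
apply/funext => h; congr (_ * _); rewrite [x + h *: v + _]addrAC.
by rewrite [_ - f (x + h *: v) - f _]addrAC.
Qed.

End PartialDerivatives.

Lemma pid_mxS {R : pzSemiRingType} n (i : 'I_n) :
  pid_mx i.+1 = pid_mx i + delta_mx i i :> 'M[R]_n.
Proof.
apply/matrixP => l j; rewrite !mxE -natrD ltnS leq_eqVlt -!val_eqE /=; congr _%:R.
by case: (ltngtP l i) => [||->]; case: (eqVneq (l : nat) j) => //=; lia.
Qed.

Lemma mulmx_delta_diag {R : pzSemiRingType} n (u : 'rV[R]_n) i :
  u *m delta_mx i i = u 0 i *: delta_mx 0 i.
Proof.
apply/rowP => j; rewrite !mxE (bigD1 i)//= big1 ?addr0 ?mxE ?eqxx// => l /negPf li.
by rewrite mxE li mulr0.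
Qed.

Lemma near_coordinate_increment {R : realType} n (f : 'rV[R]_n -> R) x (i : 'I_n) (e : R) : 0 < e ->
  (\forall y \near x, derivable f y (delta_mx 0 i)) ->
  {for x, continuous ('D_(delta_mx 0 i) f)} -> \forall u \near (0 : 'rV[R]_n),
    `|f (x + u *m pid_mx i.+1) - f (x + u *m pid_mx i) - u 0 i * 'D_(delta_mx 0 i) f x| <=
    e * `|u|.
Proof.
move=> e0 df cf; pose z (u : 'rV[R]_n) := x + u *m pid_mx i.
have cz : z u @[u --> (0 : 'rV[R]_n)] --> z 0.
  exact: cvgD (cvg_cst x) (@mulmxr_continuous R 1 n n (pid_mx i) 0).
rewrite {2}/z mul0mx addr0 in cz.
have cu : (u : 'rV[R]_n) 0 i @[u --> (0 : 'rV[R]_n)] --> (0 : R).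
  by have := @coord_continuous R 1 n 0 i 0; rewrite /continuous_at mxE.
have : \forall u \near (0 : 'rV[R]_n),
    `|f (z u + u 0 i *: delta_mx 0 i) - f (z u) - u 0 i * 'D_(delta_mx 0 i) f x| <= e * `|u 0 i|.
  by have /(_ _ _ _ _ (strict_derivative df cf e0)) := cvg_pair cz cu; exact.
apply: filterS => u.
rewrite pid_mxS mulmxDr addrA mulmx_delta_diag => /le_trans; apply.
apply: ler_wpM2l; first exact: ltW.
by rewrite [leRHS]mx_normrE; apply: (le_bigmax _ (fun ij => `|u ij.1 ij.2|) (0, i)).
Qed.

Lemma differentiable_of_partials {R : realType} n (f : 'rV[R]_n -> R) x :
  (forall i, \forall y \near x, derivable f y (delta_mx 0 i)) ->
  (forall i, {for x, continuous ('D_(delta_mx 0 i) f)}) -> differentiable f x.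
Proof.
move=> df cf; pose grad : 'cV[R]_n := \col_i 'D_(delta_mx 0 i) f x.
pose L := [the {linear 'rV[R]_n -> R} of coordmx 0 0 \o mulmxr grad].
have LE u : L u = \sum_i u 0 i * 'D_(delta_mx 0 i) f x.
  by rewrite /= /coordmx mxE; apply: eq_bigr => i _; rewrite mxE.
have cL : continuous L.
  move=> u; apply: continuous_comp; first exact: mulmxr_continuous.
  exact: coord_continuous.
suff littleo : f \o shift x = cst (f x) + L +o_ (0 : 'rV[R]_n) id.
  by apply/diff_locallyP; rewrite (diff_unique cL littleo).
apply/eqaddoP => _/posnumP[e].
have e'0 : 0 < e%:num / (n%:R + 1) by rewrite divr_gt0// ltr_wpDl.
pose small_increment (i : 'I_n) : set 'rV[R]_n := [set u |
  `|f (x + u *m pid_mx i.+1) - f (x + u *m pid_mx i) - u 0 i * 'D_(delta_mx 0 i) f x| <=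
  e%:num / (n%:R + 1) * `|u|].
have near_small i : \forall u \near (0 : 'rV[R]_n), small_increment i u.
  exact: near_coordinate_increment.
have : \forall u \near (0 : 'rV[R]_n), forall i, small_increment i u.
  exact: filter_forall near_small.
apply: filterS => u small; pose z (j : nat) := x + u *m pid_mx j.
have telescope : f (u + x) - f x = \sum_(i < n) (f (z i.+1) - f (z i)).
  rewrite -(big_mkord xpredT (fun i => f (z i.+1) - f (z i))) telescope_sumr//.
  by rewrite /z pid_mx_1 pid_mx_0 mulmx1 mulmx0 addr0 [u + x]addrC.
rewrite -![(_ + _ : _ -> _) _]/(_ + _) -![(- _ : _ -> _) _]/(- _) /= opprD addrA.
rewrite telescope LE -sumrB; apply: le_trans (ler_norm_sum _ _ _) _.
apply: le_trans (ler_sum _ (fun i _ => small i)) _.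
rewrite sumr_const card_ord -[leLHS]mulr_natl mulrA ler_wpM2r// mulrCA ler_piMr//.
by rewrite ler_pdivrMr ?ltr_wpDl// mul1r lerDl.
Qed.

Section Smoothness.
Context {R : realType} {V W : normedModType R}.
Implicit Types (U : set V) (f : V -> W).

Lemma open_near U (P : V -> Prop) x : open U -> (forall y, U y -> P y) -> U x ->
  \forall y \near x, P y.
Proof. by move=> oU UP Ux; apply: filterS (open_nbhs_nbhs (conj oU Ux)). Qed.

Lemma iderive_rcons f vs v : iderive f (rcons vs v) = iderive ('D_v f) vs.
Proof. by elim: vs => //= w vs ->. Qed.

Lemma smooth_on_derive U f v : smooth_on U f -> smooth_on U ('D_v f).
Proof. by move=> sf vs x Ux; rewrite -iderive_rcons; exact: sf. Qed.

Lemma smooth_on_continuous U f x : smooth_on U f -> U x -> {for x, continuous f}.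
Proof. by move=> sf /(sf [::])[]. Qed.

Lemma smooth_on_derivable U f x v : smooth_on U f -> U x -> derivable f x v.
Proof. by move=> sf /(sf [::])[_]; apply. Qed.

Lemma eq_in_iderive U f g vs : open U -> {in U, f =1 g} -> {in U, iderive f vs =1 iderive g vs}.
Proof.
move=> oU fg; elim: vs => [//|v vs IH] x /set_mem Ux /=; apply: near_eq_derive.
by apply: (open_near oU _ Ux) => y Uy; exact: IH (mem_set Uy).
Qed.

Lemma eq_in_smooth_on U f g : open U -> {in U, f =1 g} -> smooth_on U f -> smooth_on U g.
Proof.
move=> oU fg sf vs x Ux; have [cf df] := sf vs x Ux.
have near_fg : {near x, iderive f vs =1 iderive g vs}.
  by apply: (open_near oU _ Ux) => y Uy; exact: eq_in_iderive fg _ (mem_set Uy).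
split=> [|v]; first exact: near_eq_continuous near_fg cf.
exact: near_eq_derivable near_fg (df v).
Qed.

Lemma derive_comp_linear (W' : normedModType R) (L : {linear W -> W'}) U f x v :
  continuous L -> smooth_on U f -> U x -> 'D_v (L \o f) x = L ('D_v f x).
Proof.
move=> cL sf Ux; have /derivableP df := smooth_on_derivable (v := v) sf Ux.
by have [_ ->] := is_derive_comp_linear cL df.
Qed.

Lemma iderive_comp_linear (W' : normedModType R) (L : {linear W -> W'}) U f vs :
  open U -> continuous L -> smooth_on U f ->
  {in U, iderive (L \o f) vs =1 L \o iderive f vs}.
Proof.
move=> oU cL sf; elim: vs => [|v vs IH] x //= /set_mem Ux.
rewrite (near_eq_derive _ (open_near oU (fun y Uy => IH y (mem_set Uy)) Ux)).
have /derivableP d := (sf vs x Ux).2 v.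
by have [_ ->] := is_derive_comp_linear cL d.
Qed.

Lemma smooth_on_comp_linear (W' : normedModType R) (L : {linear W -> W'}) U f :
  open U -> continuous L -> smooth_on U f -> smooth_on U (L \o f).
Proof.
move=> oU cL sf vs x Ux; have [cf df] := sf vs x Ux.
have near_Lf : {near x, L \o iderive f vs =1 iderive (L \o f) vs}.
  by apply: (open_near oU _ Ux) => y Uy; rewrite (iderive_comp_linear vs oU cL sf) ?inE.
split=> [|v].
  by apply: near_eq_continuous near_Lf _; apply: continuous_comp => //; exact: cL.
apply: near_eq_derivable near_Lf _.
by have /derivableP/(is_derive_comp_linear cL)[] := df v.
Qed.

End Smoothness.

Section SmoothDifferentiable.
Context {R : realType} {n : nat}.
Local Notation V := 'rV[R]_n.
Implicit Types (U : set V) (x u v : V).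

Lemma smooth_real_differentiable U (f : V -> R) x :
  open U -> smooth_on U f -> U x -> differentiable f x.
Proof.
move=> oU sf Ux; apply: differentiable_of_partials => i; last first.
  exact: smooth_on_continuous (smooth_on_derive _ sf) Ux.
by apply: (open_near oU _ Ux) => y Uy; exact: smooth_on_derivable sf Uy.
Qed.

Context {p q : nat}.
Implicit Types f : V -> 'M[R]_(p, q).

Lemma smooth_on_coord U f i j : open U -> smooth_on U f -> smooth_on U (coordmx i j \o f).
Proof. by move=> oU; apply: smooth_on_comp_linear => //; exact: coordmx_continuous. Qed.

Lemma smooth_on_differentiable U f x : open U -> smooth_on U f -> U x -> differentiable f x.
Proof.
move=> oU sf Ux; apply/differentiable_mxP => i j.
exact: smooth_real_differentiable (smooth_on_coord i j oU sf) Ux.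
Qed.

Lemma smooth_on_schwarz U f x u v : open U -> smooth_on U f -> U x ->
  'D_u ('D_v f) x = 'D_v ('D_u f) x.
Proof.
move=> oU sf Ux; apply/matrixP => i j.
have derive_coord a b : ('D_a ('D_b f) x) i j = 'D_a ('D_b (coordmx i j \o f)) x.
  have := derive_comp_linear a (@coordmx_continuous R p q i j) (smooth_on_derive b sf) Ux.
  rewrite -[RHS]/(('D_a ('D_b f) x) i j) => <-; apply: near_eq_derive.
  apply: (open_near oU _ Ux) => y Uy.
  by rewrite (derive_comp_linear b (@coordmx_continuous R p q i j) sf Uy).
apply: etrans (derive_coord u v) (etrans _ (esym (derive_coord v u))).
have sfij := smooth_on_coord i j oU sf.
apply: (schwarz (f := coordmx i j \o f)) => w.
- by apply: (open_near oU _ Ux) => y Uy; exact: smooth_on_derivable sfij Uy.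
- move=> w'; apply: (open_near oU _ Ux) => y Uy.
  exact: smooth_on_derivable (smooth_on_derive w sfij) Uy.
- move=> w'; apply: smooth_on_continuous Ux; do 2 apply: smooth_on_derive.
  exact: sfij.
Qed.

End SmoothDifferentiable.

Section Jacobian.
Context {R : realType} {n p : nat}.
Local Notation V := 'rV[R]_n.
Implicit Types (U : set V) (f : V -> 'rV[R]_p) (x v : V).

Lemma smooth_on_derive_jacobian U f x v :
  open U -> smooth_on U f -> U x -> 'D_v f x = v *m 'J f x.
Proof. by move=> oU sf Ux; exact/deriveEjacobian/(smooth_on_differentiable oU sf Ux). Qed.

Lemma smooth_on_differentiable_jacobian U f x :
  open U -> smooth_on U f -> U x -> differentiable (jacobian f) x.
Proof.
move=> oU sf Ux; apply/differentiable_mxP => i j.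
apply: (smooth_real_differentiable oU _ Ux).
apply: (eq_in_smooth_on oU _ (smooth_on_coord 0 j oU (smooth_on_derive (delta_mx 0 i) sf))).
move=> y /set_mem Uy; rewrite /= /coordmx (smooth_on_derive_jacobian _ oU sf Uy).
by rewrite -rowE mxE.
Qed.

Definition push_linear_field f (B : 'M[R]_n) y := y *m B *m 'J f y.

Lemma is_derive_push_linear_field U f (B : 'M[R]_n) x w :
  open U -> smooth_on U f -> U x ->
  is_derive x w (push_linear_field f B)
    (w *m B *m 'J f x + 'D_w ('D_(x *m B) f) x).
Proof.
move=> oU sf Ux.
have dB := is_derive_mulmxr B (is_derive_id x w).
have /derivableP dJ := diff_derivable (v := w) (smooth_on_differentiable_jacobian oU sf Ux).
apply: (is_derive_eq (is_derive_mulmx dB dJ)); congr (_ + _).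
have dxB := is_derive_mulmx (is_derive_cst (x *m B) x w) dJ.
have [_ dxBE] := dxB; rewrite mul0mx add0r in dxBE; rewrite -dxBE; apply: near_eq_derive.
by apply: (open_near oU _ Ux) => y Uy; rewrite (smooth_on_derive_jacobian _ oU sf Uy).
Qed.

Lemma push_linear_field_differentiable U f (B : 'M[R]_n) x :
  open U -> smooth_on U f -> U x -> differentiable (push_linear_field f B) x.
Proof.
move=> oU sf Ux; apply: differentiable_mulmx; last first.
  exact: smooth_on_differentiable_jacobian oU sf Ux.
exact: differentiable_mulmx.
Qed.

End Jacobian.

Section LinearSubstitution.
Context {R : realType} {n p : nat} {W : normedModType R}.
Implicit Types (P : 'M[R]_(n, p)) (f : 'rV[R]_p -> W).

Lemma is_derive_substmx P f (x v : 'rV[R]_n) df : is_derive (x *m P) (v *m P) f df ->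
  is_derive x v (fun y => f (y *m P)) df.
Proof.
set q := fun h : R => h^-1 *: (((fun y => f (y *m P)) \o shift x) (h *: v) - f (x *m P)).
have qE : q = fun h : R => h^-1 *: ((f \o shift (x *m P)) (h *: (v *m P)) - f (x *m P)).
  by apply/funext => h; rewrite /q /= mulmxDl scalemxAl.
by move=> [dfx <-]; split; [move: dfx|]; rewrite /derivable /derive -/q qE.
Qed.

Lemma derive_substmx P f (x v : 'rV[R]_n) :
  'D_v (fun y => f (y *m P)) x = 'D_(v *m P) f (x *m P).
Proof.
rewrite /derive; congr (lim (_ @ 0^')); apply/funext => h.
by rewrite /= mulmxDl scalemxAl.
Qed.

Lemma iderive_substmx P f vs :
  iderive (fun y => f (y *m P)) vs = fun y => iderive f [seq v *m P | v <- vs] (y *m P).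
Proof.
elim: vs => [|v vs IH] //=; apply/funext => y.
by rewrite IH derive_substmx.
Qed.

Lemma smooth_on_substmx P f (U : set 'rV[R]_p) (U' : set 'rV[R]_n) :
  smooth_on U f -> (forall y, U' y -> U (y *m P)) -> smooth_on U' (fun y => f (y *m P)).
Proof.
move=> sf UU' vs x U'x; have [c d] := sf [seq v *m P | v <- vs] _ (UU' _ U'x).
rewrite iderive_substmx; split.
  exact: (continuous_comp (@mulmxr_continuous R 1 n p P x) c).
by move=> v; have /derivableP/is_derive_substmx[] := d (v *m P).
Qed.

End LinearSubstitution.

(** * Euclidean geometry and great circles *)

Section DotProduct.
Context {R : realType}.

Definition dot n (u v : 'rV[R]_n) : R := (u *m v^T) 0 0.

Section Theory.
Variable n : nat.
Implicit Types u v w e : 'rV[R]_n.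

Lemma mulmx_tr_dot u v : u *m v^T = (dot u v)%:M.
Proof. exact: mx11_scalar. Qed.

Lemma dot_sum u v : dot u v = \sum_i u 0 i * v 0 i.
Proof. by rewrite /dot mxE; apply: eq_bigr => i _; rewrite mxE. Qed.

Lemma dotC u v : dot u v = dot v u.
Proof. by rewrite !dot_sum; apply: eq_bigr => i _; rewrite mulrC. Qed.

Lemma dotDl u v w : dot (u + v) w = dot u w + dot v w.
Proof. by rewrite /dot mulmxDl mxE. Qed.

Lemma dotZl a u v : dot (a *: u) v = a * dot u v.
Proof. by rewrite /dot -scalemxAl mxE. Qed.

Lemma dotDr u v w : dot u (v + w) = dot u v + dot u w.
Proof. by rewrite !(dotC u) dotDl. Qed.

Lemma dotZr a u v : dot u (a *: v) = a * dot u v.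
Proof. by rewrite !(dotC u) dotZl. Qed.

Lemma dotNl u v : dot (- u) v = - dot u v.
Proof. by rewrite -scaleN1r dotZl mulN1r. Qed.

Lemma dotNr u v : dot u (- v) = - dot u v.
Proof. by rewrite !(dotC u) dotNl. Qed.

Lemma dot0l u : dot 0 u = 0.
Proof. by rewrite -(scale0r 0) dotZl mul0r. Qed.

Lemma dot0r u : dot u 0 = 0.
Proof. by rewrite dotC dot0l. Qed.

Definition dot_bilinear := (dotDl, dotDr, dotNl, dotNr, dotZl, dotZr, dot0l, dot0r).

Lemma dot_ge0 u : 0 <= dot u u.
Proof. by rewrite dot_sum; apply: sumr_ge0 => i _; rewrite -expr2 sqr_ge0. Qed.

Lemma dot_eq0 u : (dot u u == 0) = (u == 0).
Proof.
apply/eqP/eqP => [uu|->]; last exact: dot0l.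
apply/rowP => i; rewrite mxE; apply/eqP; rewrite -sqrf_eq0 expr2; apply/eqP.
by rewrite dot_sum in uu; apply: psumr_eq0P uu i isT => j _; rewrite -expr2 sqr_ge0.
Qed.

Lemma dot_gt0 u : (0 < dot u u) = (u != 0).
Proof. by rewrite lt_neqAle eq_sym dot_eq0 dot_ge0 andbT. Qed.

Lemma cauchy_schwarz u v : dot u v ^+ 2 <= dot u u * dot v v.
Proof.
have [->|v0] := eqVneq v 0; first by rewrite !dot0r mulr0 expr0n.
have := dot_ge0 (dot v v *: u - dot u v *: v).
rewrite !dot_bilinear (dotC v u) (_ : _ + _ = dot v v * (dot u u * dot v v - dot u v ^+ 2)).
  by rewrite pmulr_rge0 ?dot_gt0// subr_ge0.
by ring.
Qed.

Lemma enormE u : enorm u = Num.sqrt (dot u u).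
Proof. by rewrite dot_sum; congr Num.sqrt; apply: eq_bigr => i _; rewrite expr2. Qed.

Lemma enorm_ge0 u : 0 <= enorm u.
Proof. by rewrite enormE sqrtr_ge0. Qed.

Lemma enorm_sqr u : enorm u ^+ 2 = dot u u.
Proof. by rewrite enormE sqr_sqrtr// dot_ge0. Qed.

Lemma enorm_gt0 u : (0 < enorm u) = (u != 0).
Proof. by rewrite enormE sqrtr_gt0 dot_gt0. Qed.

Lemma enorm_eq0 u : (enorm u == 0) = (u == 0).
Proof. by rewrite -sqrf_eq0 enorm_sqr dot_eq0. Qed.

Lemma enorm0 : enorm (0 : 'rV[R]_n) = 0.
Proof. by apply/eqP; rewrite enorm_eq0. Qed.

Lemma enormZ a u : enorm (a *: u) = `|a| * enorm u.
Proof.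
by rewrite !enormE !dot_bilinear mulrA -expr2 sqrtrM ?sqr_ge0// sqrtr_sqr.
Qed.

Lemma eq_enorm u v : (enorm u == enorm v) = (dot u u == dot v v).
Proof.
by rewrite -!enorm_sqr eqrXn2 ?enorm_ge0.
Qed.

End Theory.

Lemma dot_mulmx n p (u : 'rV[R]_n) v (A : 'M[R]_(n, p)) : dot (u *m A) v = dot u (v *m A^T).
Proof. by rewrite /dot trmx_mul trmxK mulmxA. Qed.

Lemma dot_skew n (A : 'M[R]_n) u v : A^T = - A -> dot u (v *m A) = - dot (u *m A) v.
Proof. by move=> skA; rewrite [in RHS]dot_mulmx skA mulmxN dotNr opprK. Qed.

Lemma dot_isometry n p (A : 'M[R]_(n, p)) u v : A *m A^T = 1%:M ->
  dot (u *m A) (v *m A) = dot u v.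
Proof. by move=> oA; rewrite dot_mulmx -mulmxA oA mulmx1. Qed.

Lemma enorm_isometry n p (A : 'M[R]_(n, p)) u : A *m A^T = 1%:M -> enorm (u *m A) = enorm u.
Proof. by move=> oA; rewrite !enormE dot_isometry. Qed.

Lemma dot_row_mx p q (a c : 'rV[R]_p) (b d : 'rV[R]_q) :
  dot (row_mx a b) (row_mx c d) = dot a c + dot b d.
Proof. by rewrite /dot tr_row_mx mul_row_col mxE. Qed.

Lemma enorm_hsubmx_sqr p q (u : 'rV[R]_(p + q)) :
  enorm u ^+ 2 = enorm (lsubmx u) ^+ 2 + enorm (rsubmx u) ^+ 2.
Proof. by rewrite !enorm_sqr -{1 2}[u]hsubmxK dot_row_mx. Qed.

Lemma conformal_mulmx_tr p q (L : 'M[R]_(p, q)) c :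
  (forall u, dot (u *m L) (u *m L) = c * dot u u) -> L *m L^T = c%:M.
Proof.
move=> conf; have polar u v : dot (u *m L) (v *m L) = c * dot u v.
  have := conf (u + v); rewrite mulmxDl !dot_bilinear !conf (dotC (v *m L)) (dotC v).
  by lra.
apply/matrixP => i j.
have := polar (delta_mx 0 i) (delta_mx 0 j); rewrite /dot trmx_mul mulmxA -(mulmxA _ L).
by rewrite trmx_delta -!rowE -!colE !mxE andbT mulr_natr.
Qed.

Section Differentiation.
Context {V : normedModType R} (n : nat).
Implicit Types (f g : V -> 'rV[R]_n).

Lemma differentiable_dot f g x : differentiable f x -> differentiable g x ->
  differentiable (fun y => dot (f y) (g y)) x.
Proof.
move=> df dg; apply: (differentiable_mxP _ _).1 0 0; apply: differentiable_mulmx => //.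
by apply/differentiable_mxP => i j; under eq_fun do rewrite mxE; exact: (differentiable_mxP _ _).1.
Qed.

Lemma is_derive_dot f g x v df dg : is_derive x v f df -> is_derive x v g dg ->
  is_derive x v (fun y => dot (f y) (g y)) (dot df (g x) + dot (f x) dg).
Proof.
move=> hf hg.
have hgT : is_derive x v (fun y => (g y)^T) dg^T.
  apply/is_derive_mxP => i j; rewrite mxE; under eq_fun do rewrite mxE.
  exact: (is_derive_mxP _ _ _ _).1.
by have /is_derive_mxP/(_ 0 0) := is_derive_mulmx hf hgT; rewrite mxE.
Qed.

End Differentiation.

Lemma enorm_continuous n : continuous (@enorm R n).
Proof.
rewrite (_ : @enorm R n = Num.sqrt \o (fun u => dot u u)); last first.
  by apply/funext => u /=; rewrite enormE.
move=> u; apply: continuous_comp; last exact: sqrt_continuous.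
by apply: differentiable_continuous; exact: differentiable_dot.
Qed.

End DotProduct.

Lemma ord_dim1 n (i j : 'I_n) : n = 1%N -> i = j.
Proof. by move=> n1; subst n; rewrite !ord1. Qed.

Lemma sum_dim1 {V : nmodType} n (F : 'I_n -> V) i : n = 1%N -> \sum_j F j = F i.
Proof. by move=> n1; rewrite (bigD1 i)//= big1 ?addr0// => j; rewrite (ord_dim1 j i n1) eqxx. Qed.

Section SphereTangent.
Context {R : realType} {n : nat}.
Implicit Types e v w : 'rV[R]_n.

(* The sphere through [e = 0] is a point, so its tangent space is trivial. *)
Definition sphere_tangent e v := dot e v = 0 /\ (e = 0 -> v = 0).

Definition sphere_normal e v := forall w, sphere_tangent e w -> dot v w = 0.

Lemma sphere_tangent0 e : sphere_tangent e 0.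
Proof. by split; rewrite ?dot0r. Qed.

Lemma sphere_tangentZ e v a : sphere_tangent e v -> sphere_tangent e (a *: v).
Proof. by move=> [ev e0]; split=> [|/e0 ->]; rewrite ?dotZr ?ev ?mulr0 ?scaler0. Qed.

Lemma sphere_tangentP e v : e != 0 -> (sphere_tangent e v <-> dot e v = 0).
Proof. by move=> e0; split=> [[]//|ev]; split=> // /eqP; rewrite (negPf e0). Qed.

Lemma sphere_tangent_dim1 e v : n = 1%N -> sphere_tangent e v -> v = 0.
Proof.
move=> n1 [ev e0]; have [/e0//|e_neq0] := eqVneq e 0.
have [i ei] : exists i, e 0 i != 0.
  apply/existsP; apply: contraNT e_neq0; rewrite negb_exists => /forallP e_0.
  by apply/eqP/rowP => i; rewrite mxE; apply/eqP; rewrite -[_ == _]negbK.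
apply/rowP => j; rewrite [RHS]mxE (ord_dim1 j i n1); apply/eqP.
by have /eqP := ev; rewrite dot_sum (sum_dim1 _ i n1) mulf_eq0 (negPf ei).
Qed.

Lemma sphere_normal_radial e c : sphere_normal e (c *: e).
Proof. by move=> w [ew _]; rewrite dotZl ew mulr0. Qed.

Lemma tangent_component e v : (e = 0 -> v = 0) ->
  sphere_tangent e (v - (dot v e / dot e e) *: e).
Proof.
move=> ev; have [e0|e0] := eqVneq e 0.
  by rewrite ev// e0 scaler0 subr0; exact: sphere_tangent0.
apply/sphere_tangentP => //.
by rewrite !dot_bilinear (dotC e v) divfK ?subrr// dot_eq0.
Qed.

Lemma sphere_normal_collinear e v : e != 0 -> sphere_normal e v -> exists c, v = c *: e.
Proof.
move=> e0 nv; exists (dot v e / dot e e); set w := _ *: e.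
have tw : sphere_tangent e (v - w) by apply: tangent_component => /eqP; rewrite (negPf e0).
apply/eqP; rewrite -subr_eq0 -dot_eq0 dotDl dotNl dotZl.
by rewrite (nv _ tw) tw.1 mulr0 subr0.
Qed.

Lemma exists_orthogonal e : (1 < n)%N -> exists2 f, dot e f = 0 & enorm f = enorm e.
Proof.
move=> n1; have : kermx e^T != 0.
  rewrite -mxrank_eq0 mxrank_ker -lt0n subn_gt0; apply: leq_ltn_trans n1.
  exact: rank_leq_col.
case/rowV0Pn => f /sub_kermxP fe f0; exists ((enorm e / enorm f) *: f).
  by rewrite dotZr dotC /dot fe mxE mulr0.
by rewrite enormZ ger0_norm ?divr_ge0 ?enorm_ge0// divfK// enorm_eq0.
Qed.

Lemma sphere_tangent_skew e (A : 'M[R]_n) : A^T = - A -> sphere_tangent e (e *m A).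
Proof.
move=> skA; split=> [|->]; last by rewrite mul0mx.
by have := dot_skew e e skA; rewrite dotC; lra.
Qed.

Lemma sphere_tangent_derive (c : R -> 'rV[R]_n) (t : R) v :
  (forall s, dot (c s) (c s) = dot (c t) (c t)) -> is_derive t 1 c v ->
  sphere_tangent (c t) v.
Proof.
move=> norm_c dc; split=> [|ct0].
  have /(@derive_val _ _ _ _ _ _ _) := is_derive_dot dc dc.
  rewrite (_ : (fun s => _) = cst (dot (c t) (c t))) ?derive_cst ?(dotC v); last exact/funext.
  by lra.
have c0 : c = cst 0.
  apply/funext => s; apply/eqP; rewrite -dot_eq0 norm_c ct0 dot0l//.
by have [_ <-] := dc; rewrite c0 derive_cst.
Qed.

End SphereTangent.

Section GreatCircle.
Context {R : realType} {n : nat}.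
Implicit Types e v f : 'rV[R]_n.

Definition angular_speed e v : R := enorm v / enorm e.

Lemma angular_speed0 e : angular_speed e 0 = 0.
Proof. by rewrite /angular_speed enorm0 mul0r. Qed.

Lemma angular_speedZ e a v : angular_speed e (a *: v) = `|a| * angular_speed e v.
Proof. by rewrite /angular_speed enormZ mulrA. Qed.

Lemma angular_speed_gt0 e v : e != 0 -> v != 0 -> 0 < angular_speed e v.
Proof. by move=> e0 v0; rewrite divr_gt0 ?enorm_gt0. Qed.

Lemma angular_speed_eq0 e v : sphere_tangent e v -> angular_speed e v = 0 -> v = 0.
Proof.
move=> [_ e0] /eqP; rewrite mulf_eq0 invr_eq0 !enorm_eq0 => /orP[/eqP//|/eqP].
exact: e0.
Qed.

(* At speed [w = 0] the quotient is [0] and the curve is constant. *)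
Definition great_circle e v (t : R) : 'rV[R]_n :=
  let w := angular_speed e v in cos (w * t) *: e + (sin (w * t) / w) *: v.

Definition rotation_generator e v : 'M[R]_n := (dot e e)^-1 *: (e^T *m v - v^T *m e).

Lemma great_circle0 e v : great_circle e v 0 = e.
Proof. by rewrite /great_circle mulr0 cos0 sin0 mul0r scale0r addr0 scale1r. Qed.

Lemma great_circle_unit e f (s : R) : e != 0 -> enorm f = enorm e ->
  great_circle e (s *: f) 1 = cos s *: e + sin s *: f.
Proof.
move=> e0 fe; rewrite /great_circle /angular_speed enormZ fe mulfK ?enorm_eq0//.
rewrite mulr1 cos_norm scalerA; congr (_ + _ *: _).
have [->|s0] := eqVneq s 0; first by rewrite mulr0 sin0.
by case: (ger0P s) => _; [rewrite divfK|rewrite sinN invrN mulrNN divfK].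
Qed.

Lemma angular_speed_sqr e v : angular_speed e v ^+ 2 = dot v v / dot e e.
Proof. by rewrite /angular_speed expr_div_n !enorm_sqr. Qed.

Lemma rotation_generator_tr e v : (rotation_generator e v)^T = - rotation_generator e v.
Proof. by rewrite linearZ linearB /= !trmx_mul !trmxK -scalerN opprB. Qed.

Lemma mul_rotation_generator e v u :
  u *m rotation_generator e v = (dot u e / dot e e) *: v - (dot u v / dot e e) *: e.
Proof.
rewrite -scalemxAr mulmxBr !mulmxA !mulmx_tr_dot !mul_scalar_mx scalerBr !scalerA.
by rewrite ![_^-1 * _]mulrC.
Qed.

Lemma rotation_generator0l v : rotation_generator 0 v = 0.
Proof. by rewrite /rotation_generator trmx0 mul0mx mulmx0 subrr scaler0. Qed.

Lemma mul_generator_base e v : sphere_tangent e v -> e *m rotation_generator e v = v.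
Proof.
move=> [ev e0]; rewrite mul_rotation_generator ev mul0r scale0r subr0.
have [/e0 ->|e_neq0] := eqVneq e 0; first exact: scaler0.
by rewrite divff ?scale1r// dot_eq0.
Qed.

Lemma mul_generator_velocity e v : sphere_tangent e v ->
  v *m rotation_generator e v = - angular_speed e v ^+ 2 *: e.
Proof.
move=> [ev _]; rewrite mul_rotation_generator angular_speed_sqr dotC ev mul0r scale0r.
by rewrite sub0r scaleNr.
Qed.

Lemma great_circle_generator e v t : sphere_tangent e v ->
  let w := angular_speed e v in
  great_circle e v t *m rotation_generator e v = cos (w * t) *: v - (w * sin (w * t)) *: e.
Proof.
move=> ev w; rewrite /great_circle -/w mulmxDl -!scalemxAl mul_generator_base//.
rewrite mul_generator_velocity// -/w scalerA -[in RHS]scaleNr; congr (_ + _ *: _).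
have [->|w0] := eqVneq w 0; first by rewrite !mul0r sin0 !mul0r oppr0.
by field.
Qed.

Lemma great_circle_generator2 e v t : sphere_tangent e v ->
  great_circle e v t *m rotation_generator e v *m rotation_generator e v =
  - angular_speed e v ^+ 2 *: great_circle e v t.
Proof.
move=> ev; rewrite great_circle_generator// mulmxBl -!scalemxAl mul_generator_base//.
rewrite mul_generator_velocity// /great_circle scalerDr !scalerA.
set w := angular_speed e v; rewrite -[X in _ + X = _]scaleNr.
congr (_ *: _ + _ *: _); first exact: mulrC.
have [->|w0] := eqVneq w 0; first by rewrite expr0n !mul0r oppr0 mul0r.
by field.
Qed.

Lemma is_derive_great_circle e v (t : R) : sphere_tangent e v ->
  is_derive t 1 (great_circle e v) (great_circle e v t *m rotation_generator e v).
Proof.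
move=> ev; rewrite great_circle_generator//; set w := angular_speed e v.
have dw : is_derive t 1 ( *%R w) w.
  rewrite (_ : *%R w = w *: @id R :> (R -> R))//.
  by apply: is_derive_eq; rewrite /GRing.scale /= mulr1.
have dcos := is_derive1_comp (is_derive_cos (w * t)) dw.
have dsin := is_derive1_comp (is_derive_sin (w * t)) dw.
apply/is_derive_mxP => i j.
rewrite (_ : (fun s => _) = e i j *: (cos \o *%R w) + (v i j / w) *: (sin \o *%R w)).
  apply: (is_derive_eq (is_deriveD (is_deriveZ (e i j) dcos) (is_deriveZ (v i j / w) dsin))).
  rewrite !mxE /GRing.scale /=.
  have [w0|w0] := eqVneq w 0; last by field.
  rewrite w0 invr0 !mul0r !mulr0 cos0 mul1r !addr0 subr0.
  move/eqP: w0; rewrite mulf_eq0 invr_eq0 !enorm_eq0 => /orP[/eqP->|/eqP/ev.2 ->];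
    by rewrite mxE.
apply/funext => s; rewrite !mxE /=.
congr (_ + _); first exact: mulrC.
by rewrite -[RHS]/(_ * _) mulrAC [RHS]mulrAC [v i j * _]mulrC.
Qed.

End GreatCircle.

Section Rodrigues.
Context {R : realType} {n : nat} (S : 'M[R]_n) (w : R).
Hypotheses (skew_S : S^T = - S) (S_cubed : S *m S *m S = - w ^+ 2 *: S) (w_neq0 : w != 0).

(* exp (t S), written out with Rodrigues' formula *)
Definition rodrigues (t : R) : 'M[R]_n :=
  1%:M + (sin (w * t) / w) *: S + ((1 - cos (w * t)) / w ^+ 2) *: (S *m S).

Lemma mul_rodrigues (v : 'rV[R]_n) t : v *m rodrigues t =
  v + (sin (w * t) / w) *: (v *m S) + ((1 - cos (w * t)) / w ^+ 2) *: (v *m S *m S).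
Proof. by rewrite !mulmxDr mulmx1 -!scalemxAr mulmxA. Qed.

Lemma rodrigues0 : rodrigues 0 = 1%:M.
Proof. by rewrite /rodrigues mulr0 sin0 cos0 subrr !mul0r !scale0r !addr0. Qed.

Lemma rodriguesD s t : rodrigues s *m rodrigues t = rodrigues (s + t).
Proof.
apply/row_matrixP => i; rewrite !rowE mulmxA; move: (delta_mx 0 i) => v.
have cubed : v *m S *m S *m S = - w ^+ 2 *: (v *m S) by rewrite scalemxAr -S_cubed !mulmxA.
rewrite !mul_rodrigues !mulmxDl -!scalemxAl cubed -!scalemxAl mulrDr sinD cosD.
by apply/rowP => j; rewrite !mxE; field.
Qed.

Lemma rodrigues_tr t : (rodrigues t)^T = rodrigues (- t).
Proof.
rewrite /rodrigues !linearD !linearZ /= tr_scalar_mx trmx_mul skew_S mulrN sinN cosN.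
by rewrite mulNmx mulmxN opprK mulNr scalerN scaleNr.
Qed.

Lemma rodrigues_SO t : SOmx (rodrigues t).
Proof.
have orth s : rodrigues s *m (rodrigues s)^T = 1%:M.
  by rewrite rodrigues_tr rodriguesD subrr rodrigues0.
split=> //; have -> : t = t / 2 + t / 2 by lra.
by rewrite -rodriguesD det_mulmx -[X in _ * X]det_tr -det_mulmx orth det1.
Qed.

End Rodrigues.

Section SpecialOrthogonal.
Context {R : realType}.

Lemma SOmx1 n : SOmx (1%:M : 'M[R]_n).
Proof. by split; rewrite ?det1// trmx1 mulmx1. Qed.

Lemma SOmx_dim1 n (A : 'M[R]_n) : n = 1%N -> SOmx A -> A = 1%:M.
Proof.
move=> n1; subst n => -[_]; rewrite det_mx11 => A00.
by apply/matrixP => i j; rewrite !ord1 A00 mxE.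
Qed.

Lemma great_circle_SO n (e v : 'rV[R]_n) t : sphere_tangent e v ->
  exists2 A, SOmx A & great_circle e v t = e *m A.
Proof.
move=> ev; pose w := angular_speed e v; pose S := rotation_generator e v.
have [w0|w0] := eqVneq w 0.
  exists 1%:M; first exact: SOmx1.
  by rewrite mulmx1 /great_circle -/w w0 mul0r cos0 invr0 mulr0 scale0r addr0 scale1r.
have S_cubed : S *m S *m S = - w ^+ 2 *: S.
  apply/row_matrixP => i; rewrite !rowE !mulmxA -[RHS]scalemxAr.
  have -> : delta_mx 0 i *m S = _ := mul_rotation_generator e v _.
  set a := _ / _; set b := _ / _; rewrite !mulmxBl -!scalemxAl mul_generator_base//.
  rewrite mul_generator_velocity// -!scalemxAl mul_generator_base// -/w scalerBr !scalerA.
  by rewrite [a * _]mulrC [b * _]mulrC.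
exists (rodrigues S w t); first exact: rodrigues_SO (rotation_generator_tr e v) S_cubed w0 t.
rewrite mul_rodrigues mul_generator_base// mul_generator_velocity// /great_circle -/w.
by apply/rowP => i; rewrite !mxE; field.
Qed.

Lemma sphere_great_circle n (e y : 'rV[R]_n) : (1 < n)%N -> enorm y = enorm e ->
  exists2 v, sphere_tangent e v & y = great_circle e v 1.
Proof.
move=> n1 ye; have [e0|e0] := eqVneq e 0.
  exists 0; first exact: sphere_tangent0.
  by apply/eqP; rewrite /great_circle e0 !scaler0 addr0 -enorm_eq0 ye e0 enorm0.
have ee : 0 < dot e e by rewrite dot_gt0.
have yy : dot y y = dot e e by rewrite -!enorm_sqr ye.
pose c := dot y e / dot e e.
have c_le1 : c ^+ 2 <= 1.
  rewrite expr_div_n ler_pdivrMr ?exprn_gt0// mul1r expr2 -[X in _ <= X * _]yy.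
  exact: cauchy_schwarz.
have cos_c : cos (acos c) = c by rewrite acosK// in_itv /=; apply/andP; split; nra.
have sin_c : sin (acos c) ^+ 2 = 1 - c ^+ 2 by rewrite sin2cos2 cos_c.
pose z := y - c *: e.
have [ez _] : sphere_tangent e z by apply: tangent_component => /eqP; rewrite (negPf e0).
have zz : dot z z = sin (acos c) ^+ 2 * dot e e.
  rewrite sin_c /z !dot_bilinear yy (dotC e y) (_ : dot y e = c * dot e e); first by ring.
  by rewrite /c divfK// gt_eqF.
suff [f [ef fe yf]] : exists f, [/\ dot e f = 0, enorm f = enorm e & z = sin (acos c) *: f].
  exists (acos c *: f); first by apply: sphere_tangentZ; exact/sphere_tangentP.
  by rewrite great_circle_unit// cos_c -yf addrC subrK.
have [s0|s0] := eqVneq (sin (acos c)) 0; last first.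
  exists ((sin (acos c))^-1 *: z); rewrite dotZr ez mulr0 scalerA divff// scale1r; split=> //.
  by apply/eqP; rewrite eq_enorm dotZl dotZr zz; apply/eqP; field.
have [f ef fe] := exists_orthogonal e n1; exists f; rewrite s0 scale0r; split=> //.
by apply/eqP; rewrite -dot_eq0 zz s0 expr0n mul0r.
Qed.

Lemma SO_transitive n (e y : 'rV[R]_n) : (1 < n)%N -> enorm y = enorm e ->
  exists2 A, SOmx A & y = e *m A.
Proof.
by move=> n1 /(sphere_great_circle n1)[v ev ->]; exact: great_circle_SO.
Qed.

Lemma SO_great_circle n (e : 'rV[R]_n) A : SOmx A ->
  exists2 v, sphere_tangent e v & e *m A = great_circle e v 1.
Proof.
move=> sA; have [n1|n1|n1] := ltngtP n 1; last first.
- exists 0; first exact: sphere_tangent0.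
  by rewrite (SOmx_dim1 n1 sA) mulmx1 /great_circle angular_speed0 mul0r cos0 scale1r scaler0 addr0.
- by apply: sphere_great_circle => //; apply: enorm_isometry; case: sA.
exists 0; first exact: sphere_tangent0.
by apply/rowP => i; exfalso; have := ltn_ord i; lia.
Qed.

End SpecialOrthogonal.

Section GreatCircleODE.
Context {R : realType} {n : nat}.

Lemma harmonic_oscillator_eq0 (d dd : R -> 'rV[R]_n) w : d 0 = 0 -> dd 0 = 0 ->
  (forall t : R, is_derive t 1 d (dd t)) -> (forall t : R, is_derive t 1 dd (- w ^+ 2 *: d t)) ->
  forall t, d t = 0.
Proof.
move=> d0 dd0 der_d der_dd; pose energy (t : R) := dot (dd t) (dd t) + w ^+ 2 * dot (d t) (d t).
have energy_const (t : R) : energy t = energy 0.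
  apply: (is_derive_0_is_cst (f := energy)) => s.
  have e1 := is_derive_dot (der_dd s) (der_dd s); have e2 := is_derive_dot (der_d s) (der_d s).
  apply: (is_derive_eq (is_deriveD e1 (is_deriveZ (w ^+ 2) e2))).
  by rewrite /GRing.scale /= !dotZl !dotZr (dotC (d s)); ring.
have dd_eq0 (t : R) : dd t = 0.
  have := energy_const t; rewrite /energy d0 dd0 !dot0l mulr0 addr0 => e.
  apply/eqP; rewrite -dot_eq0 eq_le dot_ge0 andbT.
  by have := mulr_ge0 (sqr_ge0 w) (dot_ge0 (d t)); lra.
have d_const (a b : R) : a <= b -> d a = d b.
  by move=> ab; apply: is_derive_0_segment ab _ => s _; rewrite -(dd_eq0 s).
by move=> t; rewrite -d0; have [/d_const|/ltW/d_const] := leP 0 t.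
Qed.

Lemma great_circle_ode (c dc : R -> 'rV[R]_n) :
  (forall t, dot (c t) (c t) = dot (c 0) (c 0)) -> (forall t : R, is_derive t 1 c (dc t)) ->
  (forall t : R, exists2 ddc, is_derive t 1 dc ddc & sphere_normal (c t) ddc) ->
  forall t, c t = great_circle (c 0) (dc 0) t.
Proof.
move=> norm_c der_c der_dc.
have tan_c (t : R) : sphere_tangent (c t) (dc t).
  by apply: sphere_tangent_derive (der_c t) => s; rewrite norm_c -(norm_c t).
have [c00|c00] := eqVneq (c 0) 0.
  move=> t; rewrite c00 (tan_c 0).2// /great_circle !scaler0 addr0.
  by apply/eqP; rewrite -dot_eq0 norm_c c00 dot0l.
have cc0 : dot (c 0) (c 0) != 0 by rewrite dot_eq0.
have speed_dc (t : R) : dot (dc t) (dc t) = dot (dc 0) (dc 0).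
  apply: (is_derive_0_is_cst (f := fun t => dot (dc t) (dc t))) => s.
  have [ddc dd nc] := der_dc s; apply: (is_derive_eq (is_derive_dot dd dd)).
  by rewrite (dotC (dc s)) (nc _ (tan_c s)) addr0.
pose w := angular_speed (c 0) (dc 0).
have {}der_dc (t : R) : is_derive t 1 dc (- w ^+ 2 *: c t).
  have ct0 : c t != 0 by rewrite -dot_eq0 norm_c.
  have [ddc dd nc] := der_dc t; have [k ddcE] := sphere_normal_collinear ct0 nc.
  suff <- : k = - w ^+ 2 by rewrite -ddcE.
  have /(@derive_val _ _ _ _ _ _ _) := is_derive_dot (der_c t) dd.
  rewrite (_ : (fun s => _) = cst 0) ?derive_cst; last by apply/funext => s; exact: (tan_c s).1.
  rewrite ddcE dotZr speed_dc norm_c angular_speed_sqr => e.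
  by apply: (mulIf cc0); rewrite mulNr divfK//; lra.
pose g := great_circle (c 0) (dc 0); pose S := rotation_generator (c 0) (dc 0).
move=> t; apply/eqP; rewrite -subr_eq0 -/g; apply/eqP.
apply: (harmonic_oscillator_eq0 (d := fun t => c t - g t)
  (dd := fun t => dc t - g t *m S) (w := w)).
- by rewrite /g great_circle0 subrr.
- by rewrite /g great_circle0 mul_generator_base// subrr.
- by move=> s; apply: is_deriveB => //; exact: is_derive_great_circle.
move=> s; rewrite scalerBr -(great_circle_generator2 s (tan_c 0)).
by apply: is_deriveB => //; apply: is_derive_mulmxr; exact: is_derive_great_circle.
Qed.

End GreatCircleODE.

(** * Integral maps of tori *)

Section PeriodLattice.
Context {R : realType}.

Lemma cosD2pi_int (t : R) (i : int) : cos (t + pi *+ 2 * i%:~R) = cos t.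
Proof.
have cosD2pi_nat (u : R) n : cos (u + pi *+ 2 * n%:R) = cos u.
  by rewrite mulr_natr; exact: periodicn (@cosD2pi R) n u.
case: i => n; first exact: cosD2pi_nat.
by rewrite NegzE -(cosD2pi_nat _ n.+1) mulrNz mulrN subrK.
Qed.

Lemma twopi_gt0 : 0 < pi *+ 2 :> R.
Proof. by rewrite pmulrn_lgt0// pi_gt0. Qed.

Lemma cos_eq1 (t : R) : cos t = 1 <-> exists i : int, t = pi *+ 2 * i%:~R.
Proof.
split=> [ct|[i ->]]; last by rewrite -[_ * _]add0r cosD2pi_int cos0.
pose i := Num.floor (t / (pi *+ 2)); pose u := t + pi *+ 2 * (- i)%:~R.
have cu : cos u = 1 by rewrite /u cosD2pi_int.
have /andP[u0 u2] : 0 <= u < pi *+ 2.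
  have := @real_floor_itv R (t / (pi *+ 2)) (num_real _); rewrite -/i => /andP[a b].
  rewrite ler_pdivlMr ?twopi_gt0// in a; rewrite ltr_pdivrMr ?twopi_gt0// intrD in b.
  rewrite /u mulrNz mulrN subr_ge0 [_ * i%:~R]mulrC a /=.
  by rewrite ltrBlDl; apply: lt_le_trans b _; rewrite mulrDl mul1r mulrC.
exists i; suff : u = 0 by rewrite /u mulrNz mulrN => /eqP; rewrite subr_eq0 => /eqP.
apply/eqP; rewrite eq_le u0 andbT leNgt; apply/negP => u_gt0.
have : 0 < sin (u / 2).
  apply: sin_gt0_pi; rewrite divr_gt0//= ltr_pdivrMr//.
  by move: u2; rewrite mulr2n mulr_natr mulr2n.
have := cos_mulr2n (u / 2); rewrite -[_ *+ 2]mulr_natr divfK// cu mulr2n.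
by have := cos2Dsin2 (u / 2); nra.
Qed.

End PeriodLattice.

Section IntegerSquares.
Implicit Types M K p r H : int.

Lemma eq_of_sqr_close M K : 0 <= M -> `|M ^+ 2 - K ^+ 2| < K -> M = K.
Proof.
rewrite ltr_norml !expr2 => M0 /andP[lo hi].
have [//|[MK|KM]] : M = K \/ (M + 1 <= K \/ K + 1 <= M) by lia.
  by exfalso; nia.
by exfalso; nia.
Qed.

(* Completing the square, [(2 p n)^2 - (2 p^2 i + H)^2] is independent of [i], so it vanishes
   once [i] is large. *)
Lemma square_valued_discriminant p r H :
  (forall i : int, exists n : int, p ^+ 2 * i ^+ 2 + H * i + r ^+ 2 = n ^+ 2) ->
  H ^+ 2 = 4 * p ^+ 2 * r ^+ 2.
Proof.
move=> sq; have [p0|p0] := eqVneq p 0.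
  subst p; have [->|H0] := eqVneq H 0; first by rewrite !expr0n /= mulr0 mul0r.
  have [n] := sq (- H * (r ^+ 2 + 1)).
  have H2 : 1 <= H ^+ 2 by rewrite -gtz0_ge1 exprn_even_gt0.
  by move: H2 (sqr_ge0 n) (sqr_ge0 r); rewrite !expr2; nia.
pose D := 4 * p ^+ 2 * r ^+ 2 - H ^+ 2; pose i : int := `|D| + `|H| + 1.
have [n en] := sq i; pose K := 2 * p ^+ 2 * i + H.
have DE : `|2 * p * n| ^+ 2 - K ^+ 2 = D.
  by rewrite -normrX ger0_norm ?sqr_ge0// /K /D exprMn -en; ring.
have DK : `|D| < K.
  have p2 : 1 <= p ^+ 2 by rewrite -gtz0_ge1 exprn_even_gt0.
  have : 2 * i <= 2 * p ^+ 2 * i by rewrite ler_wpM2r ?addr_ge0// ler_peMr.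
  move: (ler_norm (- H)) (normr_ge0 D) (normr_ge0 H); rewrite normrN /K.
  by move: (2 * p ^+ 2 * i); rewrite /i; move: `|D| `|H| => a b y; clear; lia.
have : D = 0 by rewrite -DE -(@eq_of_sqr_close `|2 * p * n| K) ?DE// subrr.
by move=> /eqP; rewrite subr_eq0 => /eqP.
Qed.

Lemma int_sqr_eq1 M K : M * K = 1 -> M ^+ 2 = 1.
Proof.
move=> /(congr1 absz)/eqP; rewrite abszM muln_eq1 => /andP[/eqP M1 _].
by have [->|->] : M = 1 \/ M = -1 by lia.
Qed.

End IntegerSquares.

Section ToralIsometry.
Context {R : realType}.

Lemma cos_frequency_eq1 (r : R) : 0 <= r -> (forall s, cos (r * s) = 1 <-> cos s = 1) -> r = 1.
Proof.
move=> r0 closed; have p0 : 0 < pi *+ 2 :> R := twopi_gt0.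
have [n rn] : exists n : int, r = n%:~R.
  have /closed/cos_eq1[n rn] : cos (pi *+ 2) = 1 :> R by apply/cos_eq1; exists 1; rewrite mulr1.
  by exists n; apply: (mulIf (lt0r_neq0 p0)); rewrite rn mulrC.
have r_neq0 : r != 0.
  apply/eqP => r_eq0; have : cos (r * pi) = 1 by rewrite r_eq0 mul0r cos0.
  by move/closed; rewrite cospi; lra.
have /closed/cos_eq1[j rj] : cos (r * (pi *+ 2 / r)) = 1.
  by rewrite mulrC divfK//; apply/cos_eq1; exists 1; rewrite mulr1.
have /int_sqr_eq1/(congr1 (fun i : int => i%:~R : R)) : n * j = 1.
  apply: (@intr_inj R); rewrite intrM -rn; apply: (mulfI (lt0r_neq0 p0)).
  by rewrite mulrCA -rj mulrC divfK// mulr1.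
rewrite expr2 intrM -rn -expr2 => /eqP; rewrite sqrf_eq1 => /orP[/eqP//|/eqP].
by lra.
Qed.

Lemma square_valued_form (P h Q : R) :
  (forall i j : int, exists n : int,
     P * i%:~R ^+ 2 + 2 * h * i%:~R * j%:~R + Q * j%:~R ^+ 2 = n%:~R ^+ 2) ->
  exists p r : int, forall s t : R,
    P * s ^+ 2 + 2 * h * s * t + Q * t ^+ 2 = (p%:~R * s + r%:~R * t) ^+ 2.
Proof.
move=> sq; have [p ep] := sq 1 0; have [r er] := sq 0 1; have [n en] := sq 1 1.
have {}ep : P = p%:~R ^+ 2 by rewrite -ep /= !expr0n /= expr1n; ring.
have {}er : Q = r%:~R ^+ 2 by rewrite -er /= !expr0n /= expr1n; ring.
pose H : int := n ^+ 2 - p ^+ 2 - r ^+ 2.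
have eH : 2 * h = H%:~R.
  by rewrite /H !intrD !mulrNz !rmorphXn /= -en ep er /= expr1n; ring.
have disc : H ^+ 2 = 4 * p ^+ 2 * r ^+ 2.
  apply: square_valued_discriminant => i; have [l el] := sq i 1; exists l.
  apply: (@intr_inj R); rewrite [RHS]rmorphXn /= -el eH ep er.
  by clearbody H; rewrite !intrD !intrM; ring.
have {disc} : (H - 2 * p * r) * (H + 2 * p * r) == 0.
  by apply/eqP; rewrite -subr_sqr disc; ring.
rewrite mulf_eq0 => /orP[/eqP HE|/eqP HE].
  exists p, r => s t; rewrite ep er eH (_ : H = 2 * p * r); last by lia.
  by rewrite !intrM; ring.
exists p, (- r) => s t; rewrite ep er eH (_ : H = - (2 * p * r)); last by lia.
by rewrite mulrNz !intrM mulrNz; ring.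
Qed.

Lemma toral_cover_unimodular (p r q u : int) : p * u - r * q != 0 ->
  (forall s t : R, cos (p%:~R * s + r%:~R * t) = 1 -> cos (q%:~R * s + u%:~R * t) = 1 ->
     cos s = 1 /\ cos t = 1) ->
  (p * u - r * q) ^+ 2 = 1.
Proof.
have [d dE] : exists d, d = p * u - r * q by eexists.
rewrite -dE => d0 inj.
have dR0 : d%:~R != 0 :> R by rewrite intr_eq0.
have twopi0 := lt0r_neq0 (@twopi_gt0 R).
have divisible (s t a b : int) : p * s + r * t = a * d -> q * s + u * t = b * d ->
    exists i j : int, s = d * i /\ t = d * j.
  move=> ea eb; pose x (c : int) : R := pi *+ 2 * (c%:~R / d%:~R).
  have period (c c' e : int) : c * s + c' * t = e * d ->
      cos (c%:~R * x s + c'%:~R * x t) = 1.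
    move=> /(congr1 (intr : int -> R)); rewrite intrD !intrM => ce; apply/cos_eq1; exists e.
    apply: (mulIf dR0); rewrite -[RHS]mulrA -ce /x.
    by field.
  have [/cos_eq1[i xi] /cos_eq1[j xj]] := inj _ _ (period _ _ _ ea) (period _ _ _ eb).
  exists i, j; split; apply: (@intr_inj R); rewrite intrM.
    by rewrite -(mulfI twopi0 xi) mulrC divfK.
  by rewrite -(mulfI twopi0 xj) mulrC divfK.
have [i1 [j1 [eu eq]]] : exists i j : int, u = d * i /\ - q = d * j.
  by apply: (divisible u (- q) 1 0); rewrite ?dE; ring.
have [i2 [j2 [er ep]]] : exists i j : int, - r = d * i /\ p = d * j.
  by apply: (divisible (- r) p 0 1); rewrite ?dE; ring.
apply: (@int_sqr_eq1 d (j2 * i1 - i2 * j1)); apply: (mulfI d0); rewrite mulr1 [RHS]dE.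
have -> : p * u - r * q = p * u - (- r) * (- q) by ring.
by rewrite eu eq er ep; ring.
Qed.

Lemma off_diagonal_vanish (A B p r q u : R) : A != 0 -> B != 0 -> p != 0 -> u != 0 ->
  A * (p * r) + B * (q * u) = 0 -> r * q = 0 -> r = 0 /\ q = 0.
Proof.
move=> A0 B0 p0 u0 orth /eqP; rewrite mulf_eq0 => /orP[]/eqP vanish; split=> //;
  apply/eqP; move/eqP: orth; rewrite vanish.
  by rewrite !mulr0 add0r !mulf_eq0 (negPf B0) (negPf u0) orbF.
by rewrite mul0r mulr0 addr0 !mulf_eq0 (negPf A0) (negPf p0).
Qed.

Lemma orthogonal_unimodular_split (p r q u : int) (A B : R) : 0 < A -> 0 < B ->
  A * (p%:~R * r%:~R) + B * (q%:~R * u%:~R) = 0 ->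
  let d := p * u - r * q in d ^+ 2 = 1 ->
  (p * (u * d) = 1 /\ r * (- q * d) = 0) \/ (p * (u * d) = 0 /\ r * (- q * d) = 1).
Proof.
move=> A0 B0 orth d d1.
set P : R := p%:~R; set U : R := u%:~R; set Q : R := q%:~R; set T : R := r%:~R.
have dE : d%:~R = P * U - T * Q by rewrite intrD mulrNz !intrM.
have d_neq0 : d != 0 by rewrite -sqrf_eq0 d1.
have detE : (A * P ^+ 2 + B * Q ^+ 2) * (A * T ^+ 2 + B * U ^+ 2) =
    A * B * d%:~R ^+ 2 + (A * (P * T) + B * (Q * U)) ^+ 2 by rewrite dE; ring.
have : 0 < (A * P ^+ 2 + B * Q ^+ 2) * (A * T ^+ 2 + B * U ^+ 2).
  by rewrite detE orth expr0n addr0 (pmulr_rgt0 _ (mulr_gt0 A0 B0)) exprn_even_gt0//= intr_eq0.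
have sqr_sum_ge0 (x y : R) : 0 <= A * x ^+ 2 + B * y ^+ 2.
  by rewrite addr_ge0// mulr_ge0 ?sqr_ge0 ?ltW.
move=> /lt0r_neq0; rewrite mulf_eq0 negb_or => /andP[a_neq0 b_neq0].
have a0 : 0 < A * P ^+ 2 + B * Q ^+ 2 by rewrite lt0r a_neq0 sqr_sum_ge0.
have b0 : 0 < A * T ^+ 2 + B * U ^+ 2 by rewrite lt0r b_neq0 sqr_sum_ge0.
have diag_ge0 : 0 <= p * (u * d).
  rewrite -(ler0z R) -(pmulr_rge0 _ a0) !intrM.
  have -> : (A * P ^+ 2 + B * Q ^+ 2) * (P * (U * d%:~R)) = A * (P * d%:~R) ^+ 2 +
    (A * (P * T) + B * (Q * U)) * (P * d%:~R * Q) by rewrite dE; ring.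
  by rewrite orth mul0r addr0 mulr_ge0 ?sqr_ge0 ?ltW.
have antidiag_ge0 : 0 <= r * (- q * d).
  rewrite -(ler0z R) -(pmulr_rge0 _ b0) !intrM mulrNz.
  have -> : (A * T ^+ 2 + B * U ^+ 2) * (T * (- Q * d%:~R)) = A * (T * d%:~R) ^+ 2 -
    (A * (P * T) + B * (Q * U)) * (T * d%:~R * U) by rewrite dE; ring.
  by rewrite orth mul0r subr0 mulr_ge0 ?sqr_ge0 ?ltW.
have : p * (u * d) + r * (- q * d) = 1 by rewrite -d1 /d; ring.
by move: diag_ge0 antidiag_ge0; lia.
Qed.

Lemma toral_isometry_monomial (p r q u : int) (A B a b : R) :
  0 < A -> 0 < B -> 0 < a -> 0 < b ->
  (forall s t : R, A * (p%:~R * s + r%:~R * t) ^+ 2 + B * (q%:~R * s + u%:~R * t) ^+ 2 =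
     a * s ^+ 2 + b * t ^+ 2) ->
  (forall s t : R, cos (p%:~R * s + r%:~R * t) = 1 -> cos (q%:~R * s + u%:~R * t) = 1 ->
     cos s = 1 /\ cos t = 1) ->
  [/\ p ^+ 2 = 1, u ^+ 2 = 1, r = 0 & q = 0] \/ [/\ r ^+ 2 = 1, q ^+ 2 = 1, p = 0 & u = 0].
Proof.
move=> A0 B0 a0 b0 iso inj.
set P : R := p%:~R; set U : R := u%:~R; set Q : R := q%:~R; set T : R := r%:~R.
have aE : a = A * P ^+ 2 + B * Q ^+ 2 by have := iso 1 0; rewrite !expr2; lra.
have bE : b = A * T ^+ 2 + B * U ^+ 2 by have := iso 0 1; rewrite !expr2; lra.
have orth : A * (P * T) + B * (Q * U) = 0 by have := iso 1 1; rewrite aE bE; lra.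
pose d := p * u - r * q.
have d0 : d != 0.
  apply/eqP => d0; have : a * b = A * B * d%:~R ^+ 2 + (A * (P * T) + B * (Q * U)) ^+ 2.
    by rewrite intrD mulrNz !intrM aE bE; ring.
  by rewrite d0 orth !expr0n mulr0 addr0 => /eqP; rewrite mulf_eq0 !gt_eqF.
have d1 : d ^+ 2 = 1 := toral_cover_unimodular d0 inj.
have nz (x y : int) : x * y = 1 -> x%:~R != 0 :> R.
  by move=> /int_sqr_eq1 x2; rewrite intr_eq0 -sqrf_eq0 x2.
have [A1 B1] := (lt0r_neq0 A0, lt0r_neq0 B0).
have [[diag1 anti0]|[diag0 anti1]] := orthogonal_unimodular_split A0 B0 orth d1.
  left; have diag1' : u * (p * d) = 1 by rewrite mulrCA.
  have rq0 : T * Q = 0.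
    apply/eqP; rewrite -intrM intr_eq0 -(mulrI_eq0 _ (mulfI d0)) -oppr_eq0 -anti0.
    by apply/eqP; rewrite -/d; ring.
  have [/eqP r0 /eqP q0] := off_diagonal_vanish A1 B1 (nz _ _ diag1) (nz _ _ diag1') orth rq0.
  rewrite !intr_eq0 in r0 q0; rewrite (int_sqr_eq1 diag1) (int_sqr_eq1 diag1').
  by split=> //; apply/eqP.
right; have anti1' : q * (- r * d) = 1 by rewrite -anti1 -/d; ring.
have pu0 : P * U = 0.
  apply/eqP; rewrite -intrM intr_eq0 -(mulrI_eq0 _ (mulfI d0)) -diag0; apply/eqP.
  by rewrite -/d; ring.
have orth' : A * (T * P) + B * (U * Q) = 0 by rewrite -orth; ring.
have [/eqP p0 /eqP u0] := off_diagonal_vanish A1 B1 (nz _ _ anti1) (nz _ _ anti1') orth' pu0.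
rewrite !intr_eq0 in p0 u0; rewrite (int_sqr_eq1 anti1) (int_sqr_eq1 anti1').
by split=> //; apply/eqP.
Qed.

Lemma periodic_angular_speed n (g x y : 'rV[R]_n) :
  (forall i j : int,
     cos (angular_speed g ((pi *+ 2 * i%:~R) *: x + (pi *+ 2 * j%:~R) *: y)) = 1) ->
  exists p r : int, forall s t : R,
    angular_speed g (s *: x + t *: y) = `|p%:~R * s + r%:~R * t|.
Proof.
move=> periodic; pose P := dot x x / dot g g; pose h := dot x y / dot g g.
pose Q := dot y y / dot g g.
have speedE s t : angular_speed g (s *: x + t *: y) ^+ 2 = P * s ^+ 2 + 2 * h * s * t + Q * t ^+ 2.
  rewrite angular_speed_sqr !dot_bilinear (dotC y x) /P /h /Q !expr2.
  by move: (dot g g)^-1 => c; ring.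
have [p [r sqE]] : exists p r : int, forall s t : R,
    P * s ^+ 2 + 2 * h * s * t + Q * t ^+ 2 = (p%:~R * s + r%:~R * t) ^+ 2.
  apply: square_valued_form => i j; have /cos_eq1[l wl] := periodic i j; exists l.
  apply: (mulfI (_ : (pi *+ 2 : R) ^+ 2 != 0)); first by rewrite expf_neq0 ?gt_eqF ?twopi_gt0.
  by rewrite -[RHS]exprMn -wl speedE; ring.
exists p, r => s t; apply/eqP.
by rewrite -(eqrXn2 (_ : 0 < 2)%N) ?divr_ge0 ?enorm_ge0// speedE sqE -normrX ger0_norm ?sqr_ge0.
Qed.

End ToralIsometry.

(** * Orbits of SO(k) x SO(m) *)

Section Blocks.
Context {R : realType} {k m : nat}.
Local Notation V := 'rV[R]_(k + m).
Implicit Types (x y u v w : V) (A : 'M[R]_(k + m)).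

Lemma mul_block_diag x (A : 'M[R]_k) (B : 'M[R]_m) :
  x *m block_mx A 0 0 B = row_mx (lsubmx x *m A) (rsubmx x *m B).
Proof. by rewrite -{1}[x]hsubmxK mul_row_block !mulmx0 addr0 add0r. Qed.

Lemma mul_block_antidiag x (A : 'M[R]_(k, m)) (B : 'M[R]_(m, k)) :
  x *m block_mx 0 A B 0 = row_mx (rsubmx x *m B) (lsubmx x *m A).
Proof. by rewrite -{1}[x]hsubmxK mul_row_block !mulmx0 addr0 add0r. Qed.

Lemma mul_row_mx0r (v : 'rV[R]_k) A : row_mx v 0 *m A = row_mx (v *m ulsubmx A) (v *m ursubmx A).
Proof. by rewrite -{1}[A]submxK mul_row_block !mul0mx !addr0. Qed.

Lemma mul_row_mx0l (u : 'rV[R]_m) A : row_mx 0 u *m A = row_mx (u *m dlsubmx A) (u *m drsubmx A).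
Proof. by rewrite -{1}[A]submxK mul_row_block !mul0mx !add0r. Qed.

Lemma mul_hsubmx x A : x *m A =
  row_mx (lsubmx x *m ulsubmx A + rsubmx x *m dlsubmx A)
         (lsubmx x *m ursubmx A + rsubmx x *m drsubmx A).
Proof. by rewrite -{1}[x]hsubmxK -{1}[A]submxK mul_row_block. Qed.

Definition regular_point x := ((1 < k)%N -> lsubmx x != 0) /\ rsubmx x != 0.

Lemma regular_point_neq0 x : regular_point x -> x != 0.
Proof. by move=> [_]; apply: contraNneq => ->; rewrite linear0. Qed.

Definition orbit_tangent x w :=
  sphere_tangent (lsubmx x) (lsubmx w) /\ sphere_tangent (rsubmx x) (rsubmx w).

Lemma orbit_tangent_row0 x (v : 'rV[R]_k) : sphere_tangent (lsubmx x) v ->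
  orbit_tangent x (row_mx v 0).
Proof.
by rewrite /orbit_tangent row_mxKl row_mxKr; split=> //; exact: sphere_tangent0.
Qed.

Lemma orbit_tangent_0row x (u : 'rV[R]_m) : sphere_tangent (rsubmx x) u ->
  orbit_tangent x (row_mx 0 u).
Proof.
by rewrite /orbit_tangent row_mxKl row_mxKr; split=> //; exact: sphere_tangent0.
Qed.

Definition orbit_normal x v :=
  sphere_normal (lsubmx x) (lsubmx v) /\ sphere_normal (rsubmx x) (rsubmx v).

Definition block_skew A := exists (A1 : 'M[R]_k) (A2 : 'M[R]_m),
  [/\ A = block_mx A1 0 0 A2, A1^T = - A1 & A2^T = - A2].

Definition orbit_generator x w : 'M[R]_(k + m) :=
  block_mx (rotation_generator (lsubmx x) (lsubmx w)) 0
           0 (rotation_generator (rsubmx x) (rsubmx w)).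

Definition orbit_curve x w (t : R) : V :=
  row_mx (great_circle (lsubmx x) (lsubmx w) t) (great_circle (rsubmx x) (rsubmx w) t).

Lemma orbit_generator_skew x w : block_skew (orbit_generator x w).
Proof. by do 2!eexists; split; first reflexivity; exact: rotation_generator_tr. Qed.

Lemma mul_orbit_generator x w : orbit_tangent x w -> x *m orbit_generator x w = w.
Proof. by move=> [tl tr]; rewrite mul_block_diag !mul_generator_base// hsubmxK. Qed.

Lemma orbit_tangent_skew x A : block_skew A -> orbit_tangent x (x *m A).
Proof.
move=> [A1 [A2 [-> sk1 sk2]]].
by rewrite /orbit_tangent mul_block_diag row_mxKl row_mxKr; split; exact: sphere_tangent_skew.
Qed.

Lemma orbit_curve0 x w : orbit_curve x w 0 = x.
Proof. by rewrite /orbit_curve !great_circle0 hsubmxK. Qed.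

Lemma is_derive_orbit_curve x w (t : R) : orbit_tangent x w ->
  is_derive t 1 (orbit_curve x w) (orbit_curve x w t *m orbit_generator x w).
Proof.
move=> [tl tr]; rewrite mul_block_diag row_mxKl row_mxKr.
by apply: is_derive_row_mx; exact: is_derive_great_circle.
Qed.

Lemma orbit_curve_acceleration x w t : orbit_tangent x w ->
  let S := orbit_generator x w in orbit_normal (orbit_curve x w t) (orbit_curve x w t *m S *m S).
Proof.
move=> [tl tr] S; rewrite !mul_block_diag /orbit_normal !row_mxKl !row_mxKr.
by rewrite !great_circle_generator2//; split; exact: sphere_normal_radial.
Qed.

Lemma orbit_curve_SO x w t : orbit_tangent x w ->
  exists2 g, block_SO g & orbit_curve x w t = x *m g.
Proof.
move=> [/great_circle_SO tl /great_circle_SO tr].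
have [A sA eA] := tl t; have [B sB eB] := tr t.
by exists (block_mx A 0 0 B); [exists A, B|rewrite mul_block_diag -eA -eB].
Qed.

Lemma SO_orbit_curve x g : block_SO g ->
  exists2 w, orbit_tangent x w & x *m g = orbit_curve x w 1.
Proof.
move=> [A [B [/(SO_great_circle (lsubmx x))[v tv ev] [/(SO_great_circle (rsubmx x))[u tu eu] ->]]]].
exists (row_mx v u); rewrite /orbit_tangent /orbit_curve !row_mxKl !row_mxKr//.
by rewrite mul_block_diag ev eu.
Qed.

Lemma orbit_invariant_derive (h : V -> R) x w : differentiable h x ->
  (forall g, block_SO g -> h (x *m g) = h x) -> orbit_tangent x w -> 'D_w h x = 0.
Proof.
move=> dh inv_h tw; have dc := is_derive_orbit_curve 0 tw.
rewrite orbit_curve0 mul_orbit_generator// in dc.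
have dh0 : differentiable h (orbit_curve x w 0) by rewrite orbit_curve0.
have [_] := is_derive_comp_differentiable dc dh0; rewrite orbit_curve0 => <-.
rewrite (_ : h \o _ = cst (h x)) ?derive_cst//.
by apply/funext => t /=; have [g bg ->] := orbit_curve_SO t tw; exact: inv_h.
Qed.

Lemma block_SO1 : block_SO (1%:M : 'M[R]_(k + m)).
Proof.
by exists 1%:M, 1%:M; split; [exact: SOmx1|split; [exact: SOmx1|rewrite -scalar_mx_block]].
Qed.

Lemma block_SO_dotl x g : block_SO g ->
  dot (lsubmx (x *m g)) (lsubmx (x *m g)) = dot (lsubmx x) (lsubmx x).
Proof. by move=> [A [B [[oA _] [_ ->]]]]; rewrite mul_block_diag row_mxKl dot_isometry. Qed.

Lemma block_SO_dotr x g : block_SO g ->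
  dot (rsubmx (x *m g)) (rsubmx (x *m g)) = dot (rsubmx x) (rsubmx x).
Proof. by move=> [A [B [_ [[oB _] ->]]]]; rewrite mul_block_diag row_mxKr dot_isometry. Qed.

Definition block_dot (a b : R) u v :=
  a * dot (lsubmx u) (lsubmx v) + b * dot (rsubmx u) (rsubmx v).

Lemma block_dotBl a b u v w : block_dot a b (u - v) w = block_dot a b u w - block_dot a b v w.
Proof. by rewrite /block_dot !linearB /= !dot_bilinear; ring. Qed.

Lemma block_dotC a b u v : block_dot a b u v = block_dot a b v u.
Proof. by rewrite /block_dot (dotC (lsubmx u)) (dotC (rsubmx u)). Qed.

Lemma block_dotNr a b u v : block_dot a b u (- v) = - block_dot a b u v.
Proof. by rewrite /block_dot !linearN /= !dotNr; ring. Qed.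

Lemma block_dot_skew a b u v A : block_skew A ->
  block_dot a b u (v *m A) = - block_dot a b (u *m A) v.
Proof.
move=> [A1 [A2 [-> sk1 sk2]]].
rewrite /block_dot !mul_block_diag !row_mxKl !row_mxKr (dot_skew _ _ sk1) (dot_skew _ _ sk2).
by ring.
Qed.

Definition left_speed x w : R := angular_speed (lsubmx x) (lsubmx w).

Definition right_speed x w : R := angular_speed (rsubmx x) (rsubmx w).

Lemma left_speed0 x : left_speed x 0 = 0.
Proof. by rewrite /left_speed linear0 angular_speed0. Qed.

Lemma right_speed0 x : right_speed x 0 = 0.
Proof. by rewrite /right_speed linear0 angular_speed0. Qed.

Lemma left_speedZ x a w : left_speed x (a *: w) = `|a| * left_speed x w.
Proof. by rewrite /left_speed linearZ angular_speedZ. Qed.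

Lemma right_speedZ x a w : right_speed x (a *: w) = `|a| * right_speed x w.
Proof. by rewrite /right_speed linearZ angular_speedZ. Qed.

Lemma block_dot_speed a b x w : orbit_tangent x w ->
  block_dot a b w w = a * dot (lsubmx x) (lsubmx x) * left_speed x w ^+ 2 +
                      b * dot (rsubmx x) (rsubmx x) * right_speed x w ^+ 2.
Proof.
move=> [tl tr].
have dot_speed n (e v : 'rV[R]_n) : sphere_tangent e v ->
    dot v v = dot e e * angular_speed e v ^+ 2.
  move=> [_ e0]; rewrite angular_speed_sqr mulrC.
  have [/e0 ->|e_neq0] := eqVneq e 0; first by rewrite !dot0l !mul0r.
  by rewrite divfK// dot_eq0.
by rewrite /block_dot (dot_speed _ _ _ tl) (dot_speed _ _ _ tr) !mulrA.
Qed.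

Lemma orbit_normal_block_dot a b x u w : orbit_normal x u -> orbit_tangent x w ->
  block_dot a b u w = 0.
Proof. by move=> [nl nr] [tl tr]; rewrite /block_dot nl// nr// !mulr0 addr0. Qed.

Lemma orbit_normalP a b x v : (0 < k)%N -> ((1 < k)%N -> a != 0) -> b != 0 ->
  (forall w, orbit_tangent x w -> block_dot a b v w = 0) -> orbit_normal x v.
Proof.
move=> k0 a0 b0 orth; split=> w tw.
  have [k1|k1] := ltnP 1 k; last by rewrite (sphere_tangent_dim1 _ tw) ?dot0r//; lia.
  have /orth := orbit_tangent_row0 tw.
  rewrite /block_dot row_mxKl row_mxKr dot0r mulr0 addr0 => /eqP.
  by rewrite mulf_eq0 (negPf (a0 k1)) => /eqP.
have /orth := orbit_tangent_0row tw.
rewrite /block_dot row_mxKl row_mxKr dot0r mulr0 add0r => /eqP.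
by rewrite mulf_eq0 (negPf b0) => /eqP.
Qed.

Lemma differentiable_block_dot (W : normedModType R) (f g : W -> V) a b (x : W) :
  differentiable f x -> differentiable g x ->
  differentiable (fun z => block_dot a b (f z) (g z)) x.
Proof.
move=> df dg.
have dl := differentiable_dot (differentiable_comp df (differentiable_lsubmx _))
  (differentiable_comp dg (differentiable_lsubmx _)).
have dr := differentiable_dot (differentiable_comp df (differentiable_rsubmx _))
  (differentiable_comp dg (differentiable_rsubmx _)).
exact: differentiableD (differentiableZ a dl) (differentiableZ b dr).
Qed.

Lemma is_derive_block_dot (W : normedModType R) (f g : W -> V) a b (x v : W) df dg :
  is_derive x v f df -> is_derive x v g dg ->
  is_derive x v (fun z => block_dot a b (f z) (g z))
    (block_dot a b df (g x) + block_dot a b (f x) dg).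
Proof.
move=> hf hg.
have dl := is_derive_dot (is_derive_lsubmx hf) (is_derive_lsubmx hg).
have dr := is_derive_dot (is_derive_rsubmx hf) (is_derive_rsubmx hg).
apply: (is_derive_eq (is_deriveD (is_deriveZ a dl) (is_deriveZ b dr))).
by rewrite /block_dot /GRing.scale /=; ring.
Qed.

Definition sphere_tangent_mx n (e : 'rV[R]_n) : 'M[R]_n := if e == 0 then 0 else kermx e^T.

Lemma sphere_tangent_mxP n (e v : 'rV[R]_n) :
  reflect (sphere_tangent e v) (v <= sphere_tangent_mx e)%MS.
Proof.
rewrite /sphere_tangent_mx; have [->|e0] := eqVneq e 0.
  rewrite submx0; apply: (iffP eqP) => [->|[_]]; last exact.
  exact: sphere_tangent0.
apply: (iffP sub_kermxP) => [ve|[ev _]].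
  by apply/sphere_tangentP => //; rewrite dotC /dot ve mxE.
by rewrite mulmx_tr_dot dotC ev -scalemx1 scale0r.
Qed.

Lemma rank_sphere_tangent_mx n (e : 'rV[R]_n) : (0 < n)%N -> ((1 < n)%N -> e != 0) ->
  \rank (sphere_tangent_mx e) = n.-1.
Proof.
rewrite /sphere_tangent_mx => n0 e_n; have [e0|e0] := eqVneq e 0; last first.
  by rewrite mxrank_ker mxrank_tr rank_rV e0 subn1.
by rewrite mxrank0; case: ltnP e_n => [_ /(_ isT)|]; [rewrite e0 eqxx|lia].
Qed.

Definition orbit_tangent_mx x : 'M[R]_(k + m) :=
  block_mx (sphere_tangent_mx (lsubmx x)) 0 0 (sphere_tangent_mx (rsubmx x)).

Lemma orbit_tangent_mxP x w : reflect (orbit_tangent x w) (w <= orbit_tangent_mx x)%MS.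
Proof.
apply: (iffP submxP) => [[u ->]|[/sphere_tangent_mxP/submxP[a ea]]]; last first.
  move=> /sphere_tangent_mxP/submxP[b eb].
  by exists (row_mx a b); rewrite mul_block_diag row_mxKl row_mxKr -ea -eb hsubmxK.
rewrite /orbit_tangent mul_block_diag row_mxKl row_mxKr.
by split; apply/sphere_tangent_mxP; exact: submxMl.
Qed.

Lemma rank_orbit_tangent_mx x : (0 < k)%N -> (0 < m)%N -> regular_point x ->
  \rank (orbit_tangent_mx x) = (k.-1 + m.-1)%N.
Proof.
by move=> k0 m0 [x1 x2]; rewrite rank_diag_block_mx !rank_sphere_tangent_mx.
Qed.

End Blocks.

(** * Hessian metrics on orbits *)

Section HessianOnOrbits.
Context {R : realType} {k m : nat}.
Local Notation V := 'rV[R]_(k + m).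
Implicit Types (x u v w : V) (F : V -> R).

Lemma open_punctured : open (~` [set (0 : V)]).
Proof.
apply: closed_openC; apply: accessible_closed_set1; apply: hausdorff_accessible.
exact: norm_hausdorff.
Qed.

Lemma cvg_line x u : x + h *: u @[h --> (0 : R)^'] --> x.
Proof.
rewrite -[X in _ --> X]addr0 -(scale0r u); apply: cvg_within_filter.
by apply: cvgD; [exact: cvg_cst|apply: cvgZr_tmp; exact: cvg_id].
Qed.

Lemma derive_line_factor (g q : V -> R) x u : g x = 0 -> {for x, continuous q} ->
  (\forall h \near (0 : R)^', g (x + h *: u) = h * q (x + h *: u)) -> 'D_u g x = q x.
Proof.
move=> g0 cq gq; apply: cvg_lim => //.
apply: cvg_trans (cvg_comp _ _ (@cvg_line x u) cq); apply: near_eq_cvg.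
have h_neq0 : \forall h \near (0 : R)^', h != 0 by exact: nbhs_dnbhs_neq.
apply: filterS2 gq h_neq0 => h gh h0 /=.
by rewrite g0 subr0 [_ + x]addrC gh [RHS]mulKf.
Qed.

Section Minkowski.
Variable F : V -> R.
Hypotheses (mF : minkowski_norm F).

Lemma minkowski_smooth : smooth_on (~` [set 0]) F.
Proof. by case: mF => _ [_ []]. Qed.

Lemma hess_metric_gt0 x v : x != 0 -> v != 0 -> 0 < hess_metric F x v v.
Proof. by case: mF => _ [_ [_ [_ [_]]]]; apply. Qed.

Lemma minkowski_differentiable x : x != 0 -> differentiable F x.
Proof.
by move=> /eqP x0; exact: (smooth_real_differentiable open_punctured minkowski_smooth).
Qed.

Lemma energy_differentiable x : x != 0 -> differentiable (energy F) x.
Proof.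
move=> /minkowski_differentiable dF.
rewrite (_ : energy F = (2^-1 : R) *: (F ^+ 2)); last first.
  by apply/funext => y; rewrite /energy mulrC.
exact: differentiableZ (differentiableX _ dF).
Qed.

Lemma derive_energy x v : x != 0 -> 'D_v (energy F) x = F x * 'D_v F x.
Proof.
move=> /minkowski_differentiable/diff_derivable-/(_ v)/derivableP dF.
rewrite (_ : energy F = (2^-1 : R) *: (F ^+ 2)); last first.
  by apply/funext => y; rewrite /energy mulrC.
have [_ ->] := is_deriveZ (2^-1) (is_deriveX 2 dF).
by rewrite /GRing.scale /= expr1; field.
Qed.

Lemma derive_energy_continuous x v : x != 0 -> {for x, continuous ('D_v (energy F))}.
Proof.
move=> x0; have /eqP Ux := x0.
have near_energy : {near x, (fun y => F y * 'D_v F y) =1 'D_v (energy F)}.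
  by apply: (open_near open_punctured _ Ux) => y /eqP y0; rewrite derive_energy.
apply: near_eq_continuous near_energy _; apply: continuousM.
  exact: smooth_on_continuous minkowski_smooth Ux.
exact: smooth_on_continuous (smooth_on_derive v minkowski_smooth) Ux.
Qed.

Lemma derive_energy_linear x a u b v : x != 0 ->
  'D_(a *: u + b *: v) (energy F) x = a * 'D_u (energy F) x + b * 'D_v (energy F) x.
Proof.
by move=> /energy_differentiable dE; rewrite !deriveE// linearD !linearZ.
Qed.

Hypothesis iF : G_invariant_fun F.

Lemma energy_invariant g x : block_SO g -> energy F (x *m g) = energy F x.
Proof. by move=> bg; rewrite /energy iF. Qed.

Lemma derive_energy_tangent x w : x != 0 -> orbit_tangent x w -> 'D_w (energy F) x = 0.
Proof.
move=> x0; apply: orbit_invariant_derive; first exact: energy_differentiable.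
by move=> g; exact: energy_invariant.
Qed.

Definition hess_coefl x : R :=
  'D_(row_mx (lsubmx x) 0) (energy F) x / dot (lsubmx x) (lsubmx x).

Definition hess_coefr x : R :=
  'D_(row_mx 0 (rsubmx x)) (energy F) x / dot (rsubmx x) (rsubmx x).

Definition orbit_form x u v := block_dot (hess_coefl x) (hess_coefr x) u v.

Lemma derive_energy_block x z : x != 0 ->
  (lsubmx x = 0 -> lsubmx z = 0) -> (rsubmx x = 0 -> rsubmx z = 0) ->
  'D_z (energy F) x = orbit_form x x z.
Proof.
move=> x0 zl zr.
pose a := dot (lsubmx z) (lsubmx x) / dot (lsubmx x) (lsubmx x).
pose b := dot (rsubmx z) (rsubmx x) / dot (rsubmx x) (rsubmx x).
pose w := row_mx (lsubmx z - a *: lsubmx x) (rsubmx z - b *: rsubmx x).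
have tw : orbit_tangent x w.
  by rewrite /orbit_tangent row_mxKl row_mxKr; split; exact: tangent_component.
have zE : z = 1 *: w + 1 *: (a *: row_mx (lsubmx x) 0 + b *: row_mx 0 (rsubmx x)).
  rewrite !scale1r !scale_row_mx !scaler0 !add_row_mx !addr0 add0r !subrK.
  by rewrite hsubmxK.
rewrite [in LHS]zE derive_energy_linear// derive_energy_tangent// derive_energy_linear//.
rewrite /orbit_form /block_dot /hess_coefl /hess_coefr /a /b.
by rewrite (dotC (lsubmx x)) (dotC (rsubmx x)); ring.
Qed.

Lemma hess_metric_tangent x u w : x != 0 -> orbit_tangent x w ->
  hess_metric F x u w = orbit_form x u w.
Proof.
move=> x0 tw; pose S := orbit_generator x w.
have skS : block_skew S := orbit_generator_skew x w.
have xS : x *m S = w := mul_orbit_generator tw.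
have line_neq0 : \forall h \near (0 : R)^', x + h *: u != 0.
  have /open_near -/(_ (fun y => y != 0)) := open_punctured.
  by move=> /(_ x (fun y => introN eqP) (elimN eqP x0)); exact: cvg_line.
rewrite /hess_metric (derive_line_factor (q := 'D_(- (u *m S)) (energy F))).
- rewrite derive_energy_block// ?linearN /=.
  + by rewrite /orbit_form block_dotNr (block_dot_skew _ _ _ _ skS) xS opprK block_dotC.
  + by move=> lx0; rewrite mul_block_diag row_mxKl lx0 rotation_generator0l mulmx0 oppr0.
  + by move=> rx0; rewrite mul_block_diag row_mxKr rx0 rotation_generator0l mulmx0 oppr0.
- exact: derive_energy_tangent.
- exact: derive_energy_continuous.
apply: filterS line_neq0 => h xh0.
have -> : w = 1 *: ((x + h *: u) *m S) + h *: - (u *m S).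
  by rewrite scale1r mulmxDl -scalemxAl xS scalerN addrK.
rewrite derive_energy_linear// derive_energy_tangent//; last exact: orbit_tangent_skew.
by rewrite mulr0 add0r.
Qed.

Lemma derive_energy_SO g x v : block_SO g ->
  'D_(v *m g) (energy F) (x *m g) = 'D_v (energy F) x.
Proof.
move=> bg; rewrite -(derive_substmx g (energy F)); congr ('D_v _ x).
by apply/funext => y; exact: energy_invariant.
Qed.

Lemma hess_coefl_SO g x : block_SO g -> hess_coefl (x *m g) = hess_coefl x.
Proof.
move=> bg; have [A [B [[oA _] [_ eg]]]] := bg.
have lE : row_mx (lsubmx (x *m g)) 0 = row_mx (lsubmx x) 0 *m g.
  by rewrite eg !mul_block_diag !row_mxKl row_mxKr mul0mx.
rewrite /hess_coefl lE derive_energy_SO// eg mul_block_diag row_mxKl.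
by rewrite dot_isometry.
Qed.

Lemma hess_coefr_SO g x : block_SO g -> hess_coefr (x *m g) = hess_coefr x.
Proof.
move=> bg; have [A [B [_ [[oB _] eg]]]] := bg.
have rE : row_mx 0 (rsubmx (x *m g)) = row_mx 0 (rsubmx x) *m g.
  by rewrite eg !mul_block_diag !row_mxKr row_mxKl mul0mx.
rewrite /hess_coefr rE derive_energy_SO// eg mul_block_diag row_mxKr.
by rewrite dot_isometry.
Qed.

Lemma hess_coefl_gt0 x : (1 < k)%N -> lsubmx x != 0 -> 0 < hess_coefl x.
Proof.
move=> k1 lx0; have [f ef nf] := exists_orthogonal (lsubmx x) k1.
have f0 : f != 0 by rewrite -enorm_eq0 nf enorm_eq0.
have x0 : x != 0 by apply: contraNneq lx0 => ->; rewrite linear0.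
have tf : orbit_tangent x (row_mx f 0) by exact/orbit_tangent_row0/sphere_tangentP.
have : row_mx f 0 != 0 :> V.
  by apply: contraNneq f0 => /(congr1 lsubmx); rewrite row_mxKl linear0 => ->.
move/(hess_metric_gt0 x0); rewrite hess_metric_tangent// /orbit_form /block_dot.
by rewrite row_mxKl row_mxKr dot0r mulr0 addr0 pmulr_lgt0// dot_gt0.
Qed.

Lemma hess_coefr_gt0 x : (1 < m)%N -> rsubmx x != 0 -> 0 < hess_coefr x.
Proof.
move=> m1 rx0; have [f ef nf] := exists_orthogonal (rsubmx x) m1.
have f0 : f != 0 by rewrite -enorm_eq0 nf enorm_eq0.
have x0 : x != 0 by apply: contraNneq rx0 => ->; rewrite linear0.
have tf : orbit_tangent x (row_mx 0 f) by exact/orbit_tangent_0row/sphere_tangentP.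
have : row_mx 0 f != 0 :> V.
  by apply: contraNneq f0 => /(congr1 rsubmx); rewrite row_mxKr linear0 => ->.
move/(hess_metric_gt0 x0); rewrite hess_metric_tangent// /orbit_form /block_dot.
by rewrite row_mxKl row_mxKr dot0r mulr0 add0r pmulr_lgt0// dot_gt0.
Qed.

End Minkowski.

End HessianOnOrbits.

(** * Radii, directions and meridians *)

Section GreatCircleShape.
Context {R : realType}.

Lemma great_circle_closed n (e v : 'rV[R]_n) : sphere_tangent e v ->
  great_circle e v 1 = e <-> cos (angular_speed e v) = 1.
Proof.
move=> [ev e0]; rewrite /great_circle mulr1; set w := angular_speed e v.
have [e_eq0|e_neq0] := eqVneq e 0.
  by rewrite /w /angular_speed e0// enorm0 mul0r cos0 !scaler0 addr0 scale1r.
split=> [/(congr1 (dot e))|cw1].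
  rewrite dotDr !dotZr ev mulr0 addr0 -[RHS]mul1r; apply: mulIf.
  by rewrite dot_eq0.
suff -> : sin w = 0 by rewrite cw1 mul0r scale0r addr0 scale1r.
by apply/eqP; rewrite -sqrf_eq0 sin2cos2 cw1 expr1n subrr.
Qed.

Lemma great_circle_similar n p (e : 'rV[R]_n) (g : 'rV[R]_p) (K : 'M[R]_(n, p)) :
  e != 0 -> g != 0 ->
  (forall v, sphere_tangent e v ->
     sphere_tangent g (v *m K) /\ angular_speed g (v *m K) = angular_speed e v) ->
  exists a (M : 'M[R]_(n, p)), [/\ 0 < a, M *m M^T = 1%:M & forall v t, sphere_tangent e v ->
    great_circle g (v *m K) t = a *: (great_circle e v t *m M)].
Proof.
move=> e0 g0 simK; pose a := enorm g / enorm e.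
have a0 : 0 < a by rewrite divr_gt0// enorm_gt0.
have a2 : a ^+ 2 * dot e e = dot g g.
  by rewrite expr_div_n !enorm_sqr divfK// dot_eq0.
(* [L] sends [e] to [g] and agrees with [K] on the orthogonal of [e]. *)
pose L := (dot e e)^-1 *: (e^T *m g) + (1%:M - (dot e e)^-1 *: (e^T *m e)) *m K.
have mulL u : u *m L = (dot u e / dot e e) *: g + (u - (dot u e / dot e e) *: e) *m K.
  rewrite mulmxDr mulmxA mulmxBr mulmx1 -!scalemxAr !mulmxA !mulmx_tr_dot !mul_scalar_mx.
  by rewrite !scalerA ![_^-1 * _]mulrC.
have eL : e *m L = g by rewrite mulL divff ?dot_eq0// !scale1r subrr mul0mx addr0.
have tangentL v : sphere_tangent e v -> v *m L = v *m K.
  by move=> [ev _]; rewrite mulL dotC ev mul0r !scale0r subr0 add0r.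
have normK v : sphere_tangent e v -> dot (v *m K) (v *m K) = a ^+ 2 * dot v v.
  move=> /simK[_] speedE; have gg0 : dot g g != 0 by rewrite dot_eq0.
  rewrite -[LHS](divfK gg0) -angular_speed_sqr speedE angular_speed_sqr -a2.
  by rewrite mulrCA divfK ?dot_eq0.
have conformalL u : dot (u *m L) (u *m L) = a ^+ 2 * dot u u.
  pose s := dot u e / dot e e; pose v := u - s *: e.
  have tv : sphere_tangent e v by apply: tangent_component => /eqP; rewrite (negPf e0).
  have [[gv _] _] := simK v tv; have uE : u = s *: e + v by rewrite /v addrC subrK.
  rewrite mulL -/s -/v; clearbody v; rewrite uE.
  rewrite !(dotDl, dotDr, dotZl, dotZr) normK// (dotC v) (dotC (v *m K)) tv.1 gv -a2.
  by ring.
exists a, (a^-1 *: L); split=> // [|v t tv].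
  rewrite linearZ /= -scalemxAl -scalemxAr scalerA (conformal_mulmx_tr conformalL).
  by rewrite scale_scalar_mx -expr2 exprVn mulVf// sqrf_eq0 gt_eqF.
rewrite /great_circle (simK v tv).2 -scalemxAr scalerA divff ?gt_eqF// scale1r mulmxDl.
by rewrite -!scalemxAl eL tangentL.
Qed.

End GreatCircleShape.

Section PositiveMultiple.
Context {R : realType}.

Definition positive_multiple n (u v : 'rV[R]_n) := exists2 a, 0 < a & u = a *: v.

Lemma positive_multiple_refl n (u : 'rV[R]_n) : positive_multiple u u.
Proof. by exists 1; rewrite ?ltr01 ?scale1r. Qed.

Lemma positive_multiple_sym n (u v : 'rV[R]_n) : positive_multiple u v -> positive_multiple v u.
Proof.
by move=> [a a0 ->]; exists a^-1; rewrite ?invr_gt0// scalerA mulVf ?scale1r// gt_eqF.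
Qed.

Lemma positive_multiple_trans n (v u w : 'rV[R]_n) :
  positive_multiple u v -> positive_multiple v w -> positive_multiple u w.
Proof.
by move=> [a a0 ->] [b b0 ->]; exists (a * b); rewrite ?mulr_gt0// scalerA.
Qed.

Lemma positive_multiple_mulmx n p (u v : 'rV[R]_n) (A : 'M[R]_(n, p)) :
  positive_multiple u v -> positive_multiple (u *m A) (v *m A).
Proof. by move=> [a a0 ->]; exists a; rewrite ?scalemxAl. Qed.

Lemma positive_multiple_unit n (u v : 'rV[R]_n) : positive_multiple u v ->
  (enorm u)^-1 *: u = (enorm v)^-1 *: v.
Proof.
move=> [a a0 ->]; rewrite enormZ gtr0_norm// invfM scalerA mulrAC mulVf ?mul1r//.
by rewrite gt_eqF.
Qed.

End PositiveMultiple.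

Section Direction.
Context {R : realType} {n : nat}.
Implicit Types G : R -> 'rV[R]_n.

Lemma is_derive_unit_vector_radial G (s c : R) : G s != 0 -> is_derive s 1 G (c *: G s) ->
  is_derive s 1 (fun t => (enorm (G t))^-1 *: G t) 0.
Proof.
move=> G0 dG; have N0 : 0 < enorm (G s) by rewrite enorm_gt0.
have dGG := is_derive_dot dG dG; rewrite dotZl dotZr in dGG.
have GG0 : 0 < dot (G s) (G s) by rewrite dot_gt0.
have dN : is_derive s 1 (fun t => enorm (G t)) (c * enorm (G s)).
  rewrite (_ : (fun t => _) = Num.sqrt \o (fun t => dot (G t) (G t))); last first.
    by apply/funext => t; rewrite enormE.
  apply: (is_derive_eq (is_derive1_comp (is_derive1_sqrt GG0) dGG)).
  by rewrite -enormE -enorm_sqr; field; rewrite gt_eqF.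
apply/is_derive_mxP => i j; have /is_derive_mxP/(_ i j) dGij := dG.
rewrite mxE (_ : (fun t => _) = (fun t => (enorm (G t))^-1) * (fun t => G t i j)); last first.
  by apply/funext => t; rewrite mxE.
have dV := is_deriveV (f := fun t => enorm (G t)) (lt0r_neq0 N0) dN.
apply: (is_derive_eq (is_deriveM dV dGij)).
by rewrite !mxE /GRing.scale /=; field; rewrite gt_eqF.
Qed.

Lemma positive_multiple_radial_curve G (dG : R -> 'rV[R]_n) (a b : R) : a <= b ->
  (forall s : R, a <= s <= b ->
    [/\ G s != 0, is_derive s 1 G (dG s) & exists c, dG s = c *: G s]) ->
  positive_multiple (G a) (G b).
Proof.
move=> ab radG.
have [Ga _ _] : [/\ G a != 0, is_derive a 1 G (dG a) & exists c, dG a = c *: G a].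
  by apply: radG; rewrite lexx.
have [Gb _ _] : [/\ G b != 0, is_derive b 1 G (dG b) & exists c, dG b = c *: G b].
  by apply: radG; rewrite lexx ab.
exists (enorm (G a) / enorm (G b)); first by rewrite divr_gt0 ?enorm_gt0.
have unit_const : (enorm (G a))^-1 *: G a = (enorm (G b))^-1 *: G b.
  apply: (is_derive_0_segment ab (f := fun s => (enorm (G s))^-1 *: G s)) => s /radG[G0 + [c dGE]].
  by rewrite dGE; exact: is_derive_unit_vector_radial.
by rewrite -scalerA -unit_const scalerA divff ?enorm_eq0// scale1r.
Qed.

End Direction.

Section SphericalGeometry.
Context {R : realType} {k m : nat}.
Local Notation V := 'rV[R]_(k + m).
Implicit Types (x y z u v w : V) (P : 'M[R]_(k + m)).

Lemma orbit_curve_closed x w : orbit_tangent x w ->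
  orbit_curve x w 1 = x <-> cos (left_speed x w) = 1 /\ cos (right_speed x w) = 1.
Proof.
move=> [tl tr]; rewrite -(great_circle_closed tl) -(great_circle_closed tr).
rewrite /orbit_curve -{3}[x]hsubmxK.
by split=> [/eq_row_mx//|[-> ->]].
Qed.

Definition codirectional u v :=
  ((1 < k)%N -> positive_multiple (lsubmx u) (lsubmx v)) /\
  positive_multiple (rsubmx u) (rsubmx v).

Lemma codirectional_sym u v : codirectional u v -> codirectional v u.
Proof. by move=> [l r]; split=> [/l|]; exact: positive_multiple_sym. Qed.

Lemma codirectional_trans v u w : codirectional u v -> codirectional v w -> codirectional u w.
Proof.
move=> [l1 r1] [l2 r2]; split; last exact: positive_multiple_trans r1 r2.
by move=> k1; exact: positive_multiple_trans (l1 k1) (l2 k1).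
Qed.

Lemma codirectionalZ a u : 0 < a -> codirectional (a *: u) u.
Proof. by move=> a0; split=> [_|]; exists a; rewrite ?linearZ. Qed.

(* A swap of the two blocks makes sense only when both spheres are positive dimensional;
   for [k = 1] the first coordinate must be preserved, sign included. *)
Definition block_monomial P := P *m P^T = 1%:M /\
  ((exists A B, P = block_mx A 0 0 B /\ (k = 1%N -> A = 1%:M)) \/
   ((1 < k)%N /\ exists A B, P = block_mx 0 A B 0)).

Lemma block_monomial_diag A B : A *m A^T = 1%:M -> B *m B^T = 1%:M ->
  (k = 1%N -> A = 1%:M) -> block_monomial (block_mx A 0 0 B).
Proof.
move=> oA oB A1; split; last by left; exists A, B.
by rewrite tr_block_mx mulmx_block !trmx0 !mulmx0 !mul0mx oA oB !addr0 add0r scalar_mx_block.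
Qed.

Lemma block_monomial_antidiag A B : (1 < k)%N -> A *m A^T = 1%:M -> B *m B^T = 1%:M ->
  block_monomial (block_mx 0 A B 0).
Proof.
move=> k1 oA oB; split; last by right; split=> //; exists A, B.
by rewrite tr_block_mx mulmx_block !trmx0 !mulmx0 !mul0mx oA oB !addr0 !add0r scalar_mx_block.
Qed.

Lemma block_monomial_tr P : block_monomial P -> block_monomial P^T.
Proof.
move=> [oP shape]; split; first by rewrite trmxK; exact: mulmx1C.
case: shape => [[A [B [-> A1]]]|[k1 [A [B ->]]]]; rewrite tr_block_mx !trmx0; [left|right].
  by exists A^T, B^T; split=> // /A1 ->; rewrite trmx1.
by split=> //; exists B^T, A^T.
Qed.

Lemma codirectional_mulmx P u v : block_monomial P -> codirectional u v ->
  codirectional (u *m P) (v *m P).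
Proof.
move=> [_ [[A [B [-> _]]]|[k1 [A [B ->]]]]] [l r]; rewrite /codirectional.
  rewrite !mul_block_diag !row_mxKl !row_mxKr.
  by split=> [/l|]; exact: positive_multiple_mulmx.
rewrite !mul_block_antidiag !row_mxKl !row_mxKr.
by split=> [_|]; apply: positive_multiple_mulmx => //; exact: l.
Qed.

(* The radius of [x'], except that for [k = 1] it is the signed coordinate [x_1]. *)
Definition axial x : R := if k == 1%N then \sum_i lsubmx x 0 i else enorm (lsubmx x).

Definition same_radii x y := axial x = axial y /\ enorm (rsubmx x) = enorm (rsubmx y).

Lemma axialZ a x : 0 <= a -> axial (a *: x) = a * axial x.
Proof.
move=> a0; rewrite /axial linearZ /=; case: ifP => _; last by rewrite enormZ ger0_norm.
by rewrite mulr_sumr; apply: eq_bigr => i _; rewrite mxE.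
Qed.

Lemma axial_sqr x : axial x ^+ 2 = enorm (lsubmx x) ^+ 2.
Proof.
rewrite /axial; case: eqP => [k1|//]; rewrite enorm_sqr dot_sum.
have i0 : 'I_k by rewrite k1; exact: ord0.
by rewrite !(sum_dim1 _ i0 k1) expr2.
Qed.

Lemma same_radii_enorm x y : same_radii x y -> enorm x = enorm y.
Proof.
move=> [ax rx]; apply/eqP; rewrite -(eqrXn2 (n := 2)) ?enorm_ge0//.
by rewrite !enorm_hsubmx_sqr -!axial_sqr ax rx.
Qed.

Lemma axial_continuous : continuous (axial : V -> R).
Proof.
rewrite /axial => x; case: eqP => k1.
  rewrite (_ : (fun y => _) = (fun y : V => dot (lsubmx y) (const_mx 1))).
    apply: differentiable_continuous; apply: differentiable_dot => //.
    exact: differentiable_lsubmx.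
  by apply/funext => y; rewrite dot_sum; apply: eq_bigr => i _; rewrite [const_mx _ _ _]mxE mulr1.
exact: continuous_comp (@continuous_lsubmx R 1 k m x) (@enorm_continuous R k _).
Qed.

Lemma same_radii_block_SO g x : block_SO g -> same_radii (x *m g) x.
Proof.
move=> [A [B [sA [[oB _] ->]]]]; rewrite /same_radii /axial mul_block_diag row_mxKl row_mxKr.
split; last exact: enorm_isometry.
by case: eqP sA => [k1 /(SOmx_dim1 k1) ->|_ [oA _]]; [rewrite mulmx1|exact: enorm_isometry].
Qed.

Lemma orbit_of_same_radii x y : (0 < k)%N -> (1 < m)%N -> same_radii x y ->
  exists2 g, block_SO g & y = x *m g.
Proof.
move=> k0 m1 [ax rx]; have [B sB eB] := SO_transitive m1 (esym rx).
suff [A sA eA] : exists2 A, SOmx A & lsubmx y = lsubmx x *m A.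
  exists (block_mx A 0 0 B); first by exists A, B.
  by rewrite mul_block_diag -eA -eB hsubmxK.
move: ax; rewrite /axial; case: eqP => [k1|/eqP k1] ax; last first.
  by apply: SO_transitive => //; lia.
exists 1%:M; first exact: SOmx1.
by rewrite mulmx1; apply/rowP => i; have := ax; rewrite !(sum_dim1 _ i k1) => ->.
Qed.

Lemma same_radii_mulmx P x y : block_monomial P -> same_radii x y -> same_radii (x *m P) (y *m P).
Proof.
move=> [oP shape] [ax rx]; have lx : enorm (lsubmx x) = enorm (lsubmx y).
  by apply/eqP; rewrite -(eqrXn2 (n := 2)) ?enorm_ge0// -!axial_sqr ax.
case: shape oP => [[A [B [-> A1]]]|[k1 [A [B ->]]]];
  rewrite tr_block_mx !trmx0 mulmx_block !mulmx0 !mul0mx !addr0 ?add0r scalar_mx_block.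
  move=> /eq_block_mx[oA _ _ oB].
  rewrite /same_radii /axial !mul_block_diag !row_mxKl !row_mxKr !(enorm_isometry _ oB).
  split=> //; move: ax; rewrite /axial; case: eqP => [k1|_ _]; first by rewrite A1// !mulmx1.
  by rewrite !(enorm_isometry _ oA).
move=> /eq_block_mx[oA _ _ oB].
rewrite /same_radii /axial !mul_block_antidiag !row_mxKl !row_mxKr gtn_eqF//.
by rewrite !(enorm_isometry _ oA) !(enorm_isometry _ oB).
Qed.

Hypothesis k0 : (0 < k)%N.

Definition slope x := axial x / enorm (rsubmx x).

Definition axis x : 'rV[R]_k :=
  if k == 1%N then const_mx 1 else (enorm (lsubmx x))^-1 *: lsubmx x.

Lemma axial_axis x : lsubmx x = axial x *: axis x.
Proof.
rewrite /axial /axis; case: eqP => [k1|_].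
  by apply/rowP => i; rewrite [RHS]mxE (sum_dim1 _ i k1) !mxE mulr1.
have [->|lx0] := eqVneq (lsubmx x) 0; first by rewrite !scaler0.
by rewrite scalerA divff ?scale1r// enorm_eq0.
Qed.

Lemma axial_gt0 x : (1 < k)%N -> regular_point x -> 0 < axial x.
Proof. by move=> k1 [lx _]; rewrite /axial gtn_eqF// enorm_gt0 lx. Qed.

Lemma slope_gt0 x : (1 < k)%N -> regular_point x -> 0 < slope x.
Proof. by move=> k1 rx; rewrite divr_gt0 ?axial_gt0// enorm_gt0; case: rx. Qed.

Lemma slope_continuous x : regular_point x -> {for x, continuous slope}.
Proof.
move=> [_ rx0]; apply: continuousM; first exact: axial_continuous.
apply: continuousV; first by rewrite enorm_eq0.
exact: continuous_comp (@continuous_rsubmx R 1 k m x) (@enorm_continuous R m _).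
Qed.

Lemma conic_orbit_of_slope x y : regular_point x -> regular_point y -> slope x = slope y ->
  exists2 a, 0 < a & same_radii (a *: x) y.
Proof.
move=> [_ x0] [_ y0] xy; exists (enorm (rsubmx y) / enorm (rsubmx x)).
  by rewrite divr_gt0 ?enorm_gt0.
have a0 : 0 <= enorm (rsubmx y) / enorm (rsubmx x) by rewrite divr_ge0 ?enorm_ge0.
split; last by rewrite linearZ /= enormZ ger0_norm// divfK// enorm_eq0.
by rewrite axialZ// mulrAC -mulrA -/(slope x) xy mulrC /slope divfK// enorm_eq0.
Qed.

(* The point of slope [s] on the half plane through [x] swept by the two radii. *)
Definition meridian x (s : R) : V := row_mx ((s * enorm (rsubmx x)) *: axis x) (rsubmx x).

Lemma meridian_slope x : regular_point x -> meridian x (slope x) = x.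
Proof.
by move=> [_ x0]; rewrite /meridian /slope divfK ?enorm_eq0// -axial_axis hsubmxK.
Qed.

Lemma codirectional_meridian x s : regular_point x -> ((1 < k)%N -> 0 < s) ->
  codirectional (meridian x s) x.
Proof.
move=> rx s0; rewrite /codirectional row_mxKl row_mxKr; split; last exact: positive_multiple_refl.
move=> k1; have ax0 := axial_gt0 k1 rx.
have rx0 : 0 < enorm (rsubmx x) by rewrite enorm_gt0; case: rx.
exists (s * enorm (rsubmx x) / axial x); first by rewrite divr_gt0 ?mulr_gt0 ?s0.
by rewrite [in RHS]axial_axis scalerA divfK// gt_eqF.
Qed.

Lemma regular_meridian x s : regular_point x -> ((1 < k)%N -> 0 < s) ->
  regular_point (meridian x s).
Proof.
move=> rx /(codirectional_meridian rx)[l _]; case: rx => lx rx.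
rewrite /regular_point {2}/meridian row_mxKr; split=> // k1; have [a a0 ->] := l k1.
by rewrite scaler_eq0 negb_or gt_eqF// lx.
Qed.

Lemma slope_meridian x s : regular_point x -> ((1 < k)%N -> 0 < s) -> slope (meridian x s) = s.
Proof.
move=> [lx rx] s0; have rx0 : 0 < enorm (rsubmx x) by rewrite enorm_gt0.
suff axE : axial (meridian x s) = s * enorm (rsubmx x).
  by rewrite /slope axE row_mxKr mulfK// gt_eqF.
rewrite /axial row_mxKl /axis; case: eqP => [k1|/eqP k1].
  have i : 'I_k by rewrite k1; exact: ord0.
  by rewrite (sum_dim1 _ i k1) !mxE mulr1.
have k2 : (1 < k)%N by lia.
rewrite scalerA enormZ ger0_norm ?divr_ge0 ?mulr_ge0 ?enorm_ge0 ?ltW ?s0//.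
by rewrite divfK// enorm_eq0 lx.
Qed.

Lemma is_derive_meridian x (s : R) :
  is_derive s 1 (meridian x) (row_mx (enorm (rsubmx x) *: axis x) 0).
Proof.
apply: (is_derive_row_mx _ (is_derive_cst (rsubmx x) s 1)).
apply/is_derive_mxP => i j; rewrite mxE.
rewrite (_ : (fun t => _) = (enorm (rsubmx x) * axis x i j) *: @id R); last first.
  by apply/funext => t; rewrite mxE -[RHS]/(_ * t) [RHS]mulrC mulrA.
by apply: is_derive_eq; rewrite /GRing.scale /= mulr1.
Qed.

Lemma orbit_normal_meridian x s (c : R) : ((1 < k)%N -> 0 < s) -> regular_point x ->
  orbit_normal (meridian x s) (row_mx (c *: axis x) 0).
Proof.
move=> s0 [_ rx]; rewrite /orbit_normal !row_mxKl !row_mxKr; split=> w [ew e0]; last first.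
  exact: dot0l.
have [k1|k1] := ltnP 1 k; last by rewrite (sphere_tangent_dim1 _ (conj ew e0)) ?dot0r//; lia.
move/eqP: ew; rewrite !dotZl !mulf_eq0 enorm_eq0 (negPf rx) gt_eqF ?s0//= => /eqP ->.
exact: mulr0.
Qed.

End SphericalGeometry.

(** * Isometries mapping orbits to orbits *)

(* As for the Levi-Civita connection: the defect [q - p] is symmetric in its first two arguments
   and skew in its last two. *)
Lemma koszul_uniqueness (R : realFieldType) (M : Type) (P : M -> Prop) (q p : M -> M -> M -> R) :
  (forall a b c, P a -> P b -> P c -> q a b c + q a c b = p a b c + p a c b) ->
  (forall a b c, P c -> q a b c - q b a c = p a b c - p b a c) ->
  forall a b c, P a -> P b -> P c -> q a b c = p a b c.
Proof.
move=> metric torsion a b c Pa Pb Pc.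
have := metric a b c Pa Pb Pc; have := torsion a c b Pb.
have := metric c a b Pc Pa Pb; have := torsion c b a Pa.
have := metric b c a Pb Pc Pa; have := torsion b a c Pc.
by lra.
Qed.

Section OrbitPreservingIsometry.
Context {R : realType} {k m : nat}.
Local Notation V := 'rV[R]_(k + m).
Variables (F1 F2 : V -> R) (C : set V) (Phi : V -> V).
Hypotheses (k0 : (0 < k)%N) (m1 : (1 < m)%N).
Hypotheses (mF1 : minkowski_norm F1) (mF2 : minkowski_norm F2).
Hypotheses (iF1 : G_invariant_fun F1) (iF2 : G_invariant_fun F2).
Hypotheses (CG : G_invariant_set C) (isoPhi : local_hessian_isometry F1 F2 C Phi).
Hypothesis orbitPhi : maps_orbits_into_orbits C Phi.
Hypotheses (regC : forall x, C x -> regular_point x)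
  (regPhi : forall x, C x -> regular_point (Phi x)).
Implicit Types (x u v w y : V) (A B D : 'M[R]_(k + m)).

Let oC : open C. Proof. by case: isoPhi. Qed.

Let sPhi : smooth_on C Phi. Proof. by case: isoPhi => _ [_ [_ [_ [_ [[]]]]]]. Qed.

Let neq0C x : C x -> x != 0. Proof. by move/regC/regular_point_neq0. Qed.

Let neq0Phi x : C x -> Phi x != 0. Proof. by move/regPhi/regular_point_neq0. Qed.

Let derivePhi x u : C x -> 'D_u Phi x = u *m 'J Phi x.
Proof. exact: smooth_on_derive_jacobian. Qed.

Let hess_Phi x u v : C x ->
  hess_metric F2 (Phi x) (u *m 'J Phi x) (v *m 'J Phi x) = hess_metric F1 x u v.
Proof.
move=> Cx; rewrite -(derivePhi u Cx) -(derivePhi v Cx).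
by case: isoPhi => _ [_ [_ [_ [_ [_ ->]]]]].
Qed.

Lemma domain_orbit_curve x w t : C x -> orbit_tangent x w -> C (orbit_curve x w t).
Proof. by move=> Cx /(orbit_curve_SO t)[g bg ->]; exact: CG. Qed.

Lemma image_orbit_curve_SO x w t : C x -> orbit_tangent x w ->
  exists2 h, block_SO h & Phi (orbit_curve x w t) = Phi x *m h.
Proof.
move=> Cx /(orbit_curve_SO t)[g bg ->].
by have [h [bh ->]] := orbitPhi bg Cx; exists h.
Qed.

Lemma is_derive_image_orbit_curve x w (t : R) : C x -> orbit_tangent x w ->
  let c := orbit_curve x w t in
  is_derive t 1 (Phi \o orbit_curve x w) (c *m orbit_generator x w *m 'J Phi c).
Proof.
move=> Cx tw c; have Cc := domain_orbit_curve t Cx tw.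
rewrite -derivePhi//; apply: is_derive_comp_differentiable.
  exact: is_derive_orbit_curve.
exact: smooth_on_differentiable sPhi Cc.
Qed.

Lemma orbit_tangent_push x w : C x -> orbit_tangent x w -> orbit_tangent (Phi x) (w *m 'J Phi x).
Proof.
move=> Cx tw; have dc := is_derive_image_orbit_curve 0 Cx tw.
rewrite /= orbit_curve0 mul_orbit_generator// in dc.
rewrite -{1}(orbit_curve0 x w); split.
  apply: sphere_tangent_derive (is_derive_lsubmx dc) => s /=.
  by have [h bh ->] := image_orbit_curve_SO s Cx tw; rewrite block_SO_dotl// orbit_curve0.
apply: sphere_tangent_derive (is_derive_rsubmx dc) => s /=.
by have [h bh ->] := image_orbit_curve_SO s Cx tw; rewrite block_SO_dotr// orbit_curve0.
Qed.

Lemma jacobian_row_free x : C x -> row_free ('J Phi x).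
Proof.
move=> Cx; rewrite -kermx_eq0; apply/rowV0P => u /sub_kermxP uJ.
apply/eqP; apply: contraT => /(hess_metric_gt0 mF1 (neq0C Cx)).
by rewrite -hess_Phi// uJ /hess_metric derive0 ltxx.
Qed.

Lemma orbit_tangent_push_onto x w : C x -> orbit_tangent (Phi x) w ->
  exists2 v, orbit_tangent x v & w = v *m 'J Phi x.
Proof.
move=> Cx /orbit_tangent_mxP tw; set T1 := orbit_tangent_mx x; set J := 'J Phi x.
have pushT : (T1 *m J <= orbit_tangent_mx (Phi x))%MS.
  apply/row_subP => i; rewrite row_mul; apply/orbit_tangent_mxP/orbit_tangent_push => //.
  exact/orbit_tangent_mxP/row_sub.
have m0 : (0 < m)%N by lia.
have rankT : \rank (T1 *m J) = \rank (orbit_tangent_mx (Phi x)).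
  rewrite (mxrankMfree _ (jacobian_row_free Cx)) (rank_orbit_tangent_mx k0 m0 (regC Cx)).
  by rewrite (rank_orbit_tangent_mx k0 m0 (regPhi Cx)).
have /(submx_trans tw)/submxP[a ->] : (orbit_tangent_mx (Phi x) <= T1 *m J)%MS.
  by have [_ <-] := mxrank_leqif_sup pushT; rewrite rankT.
by exists (a *m T1); rewrite ?mulmxA//; apply/orbit_tangent_mxP; exact: submxMl.
Qed.

Lemma orbit_form_push x u w : C x -> orbit_tangent x w ->
  orbit_form F2 (Phi x) (u *m 'J Phi x) (w *m 'J Phi x) = orbit_form F1 x u w.
Proof.
move=> Cx tw; have := hess_Phi u w Cx.
rewrite (hess_metric_tangent mF1)//; last exact: neq0C.
rewrite (hess_metric_tangent mF2)//; [exact: neq0Phi|exact: orbit_tangent_push].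
Qed.

Lemma orbit_normal_of_push x v : C x ->
  (forall w, orbit_tangent x w -> orbit_form F2 (Phi x) v (w *m 'J Phi x) = 0) ->
  orbit_normal (Phi x) v.
Proof.
move=> Cx orth; have [lPhi rPhi] := regPhi Cx.
apply: (@orbit_normalP _ _ _ (hess_coefl F2 (Phi x)) (hess_coefr F2 (Phi x))) => //.
- by move=> k1; rewrite gt_eqF// hess_coefl_gt0// lPhi.
- by rewrite gt_eqF// hess_coefr_gt0.
by move=> w /(orbit_tangent_push_onto Cx)[v' tv' ->]; exact: orth.
Qed.

Lemma orbit_normal_push x u : C x -> orbit_normal x u -> orbit_normal (Phi x) (u *m 'J Phi x).
Proof.
move=> Cx nu; apply: orbit_normal_of_push => // w tw; rewrite orbit_form_push//.
exact: (orbit_normal_block_dot _ _ nu tw).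
Qed.

Local Notation push := (push_linear_field Phi).

(* The flat derivative of [push B] along [push A]; its component tangent to the image orbit is the
   Levi-Civita connection. *)
Definition nabla A B x := x *m A *m B *m 'J Phi x + 'D_(x *m A) ('D_(x *m B) Phi) x.

Lemma is_derive_push A B x : C x -> is_derive x (x *m A) (push B) (nabla A B x).
Proof. by move=> Cx; exact: is_derive_push_linear_field oC sPhi Cx. Qed.

Lemma nabla_metric x A B D : C x -> block_skew A -> block_skew B -> block_skew D ->
  orbit_form F2 (Phi x) (nabla A B x) (push D x) + orbit_form F2 (Phi x) (push B x) (nabla A D x) =
  orbit_form F1 x (x *m A *m B) (x *m D) + orbit_form F1 x (x *m B) (x *m A *m D).
Proof.
move=> Cx skA skB skD.
have d2 := is_derive_block_dot (hess_coefl F2 (Phi x)) (hess_coefr F2 (Phi x))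
  (is_derive_push A B Cx) (is_derive_push A D Cx).
have d1 := is_derive_block_dot (hess_coefl F1 x) (hess_coefr F1 x)
  (is_derive_mulmxr B (is_derive_id x (x *m A))) (is_derive_mulmxr D (is_derive_id x (x *m A))).
pose defect y := orbit_form F2 (Phi x) (push B y) (push D y) - orbit_form F1 x (y *m B) (y *m D).
have defect0 g : block_SO g -> defect (x *m g) = 0.
  move=> bg; apply/eqP; rewrite subr_eq0; apply/eqP.
  have := orbit_form_push (x *m g *m B) (CG bg Cx) (orbit_tangent_skew (x *m g) skD).
  have [h [bh ->]] := orbitPhi bg Cx.
  by rewrite /orbit_form !hess_coefl_SO// !hess_coefr_SO.
have d_defect : differentiable defect x.
  apply: differentiableB; apply: differentiable_block_dot;
    do ?exact: push_linear_field_differentiable oC sPhi _; exact: differentiable_mulmx.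
have := orbit_invariant_derive d_defect _ (orbit_tangent_skew x skA).
have [_ ->] := is_deriveB d2 d1 => /(_ _)/eqP; rewrite subr_eq0 => metric; apply/eqP/metric => g bg.
by rewrite defect0// -(mulmx1 x) defect0//; exact: block_SO1.
Qed.

Lemma nabla_torsion x A B : C x ->
  nabla A B x - nabla B A x = (x *m A *m B - x *m B *m A) *m 'J Phi x.
Proof.
move=> Cx; rewrite /nabla mulmxBl.
have -> := smooth_on_schwarz (x *m A) (x *m B) oC sPhi Cx.
by rewrite opprD addrACA subrr addr0.
Qed.

Lemma nabla_tangential x A B D : C x -> block_skew A -> block_skew B -> block_skew D ->
  orbit_form F2 (Phi x) (nabla A B x) (push D x) = orbit_form F1 x (x *m A *m B) (x *m D).
Proof.
move=> Cx; apply: (koszul_uniqueness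
  (q := fun A B D => orbit_form F2 (Phi x) (nabla A B x) (push D x))
  (p := fun A B D => orbit_form F1 x (x *m A *m B) (x *m D))).
  move=> {}A {}B {}D skA skB skD; have := nabla_metric Cx skA skB skD.
  by rewrite /orbit_form [X in _ + X = _]block_dotC [X in _ = _ + X]block_dotC.
move=> {}A {}B {}D skD; rewrite /orbit_form -!block_dotBl nabla_torsion//.
exact: orbit_form_push (orbit_tangent_skew x skD).
Qed.

Lemma orbit_normal_nabla x S : C x -> block_skew S -> orbit_normal x (x *m S *m S) ->
  orbit_normal (Phi x) (nabla S S x).
Proof.
move=> Cx skS nS; apply: orbit_normal_of_push => // w tw.
rewrite -{1}(mul_orbit_generator tw) -/(push _ x).
rewrite nabla_tangential//; last exact: orbit_generator_skew.
by rewrite mul_orbit_generator//; exact: (orbit_normal_block_dot _ _ nS tw).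
Qed.

Lemma image_orbit_curve x w t : C x -> orbit_tangent x w ->
  Phi (orbit_curve x w t) = orbit_curve (Phi x) (w *m 'J Phi x) t.
Proof.
move=> Cx tw; set S := orbit_generator x w; pose c := orbit_curve x w.
have skS : block_skew S := orbit_generator_skew x w.
have Cc s : C (c s) := domain_orbit_curve s Cx tw.
have dPhi (s : R) : is_derive s 1 (Phi \o c) (push S (c s)).
  exact: is_derive_image_orbit_curve.
have ddPhi (s : R) : is_derive s 1 (push S \o c) (nabla S S (c s)).
  have [_ <-] := is_derive_push S S (Cc s); apply: is_derive_comp_differentiable.
    exact: is_derive_orbit_curve.
  exact: push_linear_field_differentiable oC sPhi _.
have normal s : orbit_normal (Phi (c s)) (nabla S S (c s)).
  by apply: orbit_normal_nabla => //; exact: orbit_curve_acceleration.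
have c0 : c 0 = x := orbit_curve0 x w.
have orbit_c s : exists2 h, block_SO h & Phi (c s) = Phi (c 0) *m h.
  by rewrite c0; exact: image_orbit_curve_SO.
have dPhi0 : push S (c 0) = w *m 'J Phi x by rewrite c0 /push_linear_field mul_orbit_generator.
rewrite -{1}[Phi _]hsubmxK -dPhi0 -[in RHS]c0; congr row_mx.
  apply: (great_circle_ode (c := fun s => lsubmx (Phi (c s)))
    (dc := fun s => lsubmx (push S (c s)))) => s.
  - by have [h bh ->] := orbit_c s; exact: block_SO_dotl.
  - exact: is_derive_lsubmx.
  by exists (lsubmx (nabla S S (c s))); [exact: is_derive_lsubmx|exact: (normal s).1].
apply: (great_circle_ode (c := fun s => rsubmx (Phi (c s)))
  (dc := fun s => rsubmx (push S (c s)))) => s.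
- by have [h bh ->] := orbit_c s; exact: block_SO_dotr.
- exact: is_derive_rsubmx.
by exists (rsubmx (nabla S S (c s))); [exact: is_derive_rsubmx|exact: (normal s).2].
Qed.

Let injPhi x y : C x -> C y -> Phi x = Phi y -> x = y.
Proof.
case: isoPhi => _ [_ [_ [_ [_ [[_ [psi [_ [psiK _]]]] _]]]]] Cx Cy xy.
by rewrite -(psiK x Cx) xy psiK.
Qed.

Lemma image_orbit_curve_closed x w : C x -> orbit_tangent x w ->
  cos (left_speed (Phi x) (w *m 'J Phi x)) = 1 /\ cos (right_speed (Phi x) (w *m 'J Phi x)) = 1 <->
  cos (left_speed x w) = 1 /\ cos (right_speed x w) = 1.
Proof.
move=> Cx tw; rewrite -(orbit_curve_closed tw) -(orbit_curve_closed (orbit_tangent_push Cx tw)).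
rewrite -image_orbit_curve//; split=> [|->//]; apply: injPhi => //.
exact: domain_orbit_curve.
Qed.

Section Torus.
Variables (x : V) (v : 'rV[R]_k) (u : 'rV[R]_m).
Hypotheses (Cx : C x) (tv : sphere_tangent (lsubmx x) v) (tu : sphere_tangent (rsubmx x) u).
Hypotheses (v1 : angular_speed (lsubmx x) v = 1) (u1 : angular_speed (rsubmx x) u = 1).
Let a : V := row_mx v 0 *m 'J Phi x.
Let b : V := row_mx 0 u *m 'J Phi x.
Let w (s t : R) : V := row_mx (s *: v) (t *: u).

Let tangent_w s t : orbit_tangent x (w s t).
Proof. by rewrite /orbit_tangent row_mxKl row_mxKr; split; exact: sphere_tangentZ. Qed.

Let push_w s t : w s t *m 'J Phi x = s *: a + t *: b.
Proof. by rewrite !scalemxAl -mulmxDl !scale_row_mx !scaler0 add_row_mx addr0 add0r. Qed.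

Let speed_w s t : left_speed x (w s t) = `|s| /\ right_speed x (w s t) = `|t|.
Proof.
by rewrite /left_speed /right_speed row_mxKl row_mxKr !angular_speedZ v1 u1 !mulr1.
Qed.

Lemma torus_closed s t :
  cos (left_speed (Phi x) (s *: a + t *: b)) = 1 /\
    cos (right_speed (Phi x) (s *: a + t *: b)) = 1 <-> cos s = 1 /\ cos t = 1.
Proof.
by rewrite -push_w image_orbit_curve_closed//; have [-> ->] := speed_w s t; rewrite !cos_norm.
Qed.

Lemma torus_integral_speeds :
  (exists p r : int, forall s t : R,
     left_speed (Phi x) (s *: a + t *: b) = `|p%:~R * s + r%:~R * t|) /\
  (exists q z : int, forall s t : R,
     right_speed (Phi x) (s *: a + t *: b) = `|q%:~R * s + z%:~R * t|).
Proof.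
have leftE s t : left_speed (Phi x) (s *: a + t *: b) =
    angular_speed (lsubmx (Phi x)) (s *: lsubmx a + t *: lsubmx b).
  by rewrite /left_speed linearD !linearZ.
have rightE s t : right_speed (Phi x) (s *: a + t *: b) =
    angular_speed (rsubmx (Phi x)) (s *: rsubmx a + t *: rsubmx b).
  by rewrite /right_speed linearD !linearZ.
have closed (i j : int) : cos (pi *+ 2 * i%:~R) = 1 :> R /\ cos (pi *+ 2 * j%:~R) = 1 :> R.
  by split; apply/cos_eq1; eexists.
split.
  have [i j|p [r speedE]] := periodic_angular_speed (g := lsubmx (Phi x))
      (x := lsubmx a) (y := lsubmx b).
    by rewrite -leftE; have /torus_closed[] := closed i j.
  by exists p, r => s t; rewrite leftE.
have [i j|q [z speedE]] := periodic_angular_speed (g := rsubmx (Phi x))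
    (x := rsubmx a) (y := rsubmx b).
  by rewrite -rightE; have /torus_closed[] := closed i j.
by exists q, z => s t; rewrite rightE.
Qed.

Lemma torus_energy s t :
  hess_coefl F2 (Phi x) * dot (lsubmx (Phi x)) (lsubmx (Phi x)) *
    left_speed (Phi x) (s *: a + t *: b) ^+ 2 +
  hess_coefr F2 (Phi x) * dot (rsubmx (Phi x)) (rsubmx (Phi x)) *
    right_speed (Phi x) (s *: a + t *: b) ^+ 2 =
  hess_coefl F1 x * dot (lsubmx x) (lsubmx x) * s ^+ 2 +
  hess_coefr F1 x * dot (rsubmx x) (rsubmx x) * t ^+ 2.
Proof.
have tw := tangent_w s t; have := orbit_form_push (w s t) Cx tw.
rewrite /orbit_form (block_dot_speed _ _ (orbit_tangent_push Cx tw)) (block_dot_speed _ _ tw).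
by have [-> ->] := speed_w s t; rewrite push_w !real_normK ?num_real.
Qed.

Lemma torus_unit_speeds : (1 < k)%N ->
  [/\ left_speed (Phi x) a = 1, right_speed (Phi x) a = 0,
      left_speed (Phi x) b = 0 & right_speed (Phi x) b = 1] \/
  [/\ left_speed (Phi x) a = 0, right_speed (Phi x) a = 1,
      left_speed (Phi x) b = 1 & right_speed (Phi x) b = 0].
Proof.
move=> k1; have [lx rx] := regC Cx; have [ly ry] := regPhi Cx.
have [[p [r leftE]] [q [z rightE]]] := torus_integral_speeds.
have unit_norm (n : int) : n ^+ 2 = 1 -> `|n%:~R : R| = 1.
  by move=> /eqP; rewrite sqrf_eq1 => /orP[]/eqP ->; rewrite ?rmorphN ?normrN ?normr1.
have a_comb : 1 *: a + 0 *: b = a by rewrite scale1r scale0r addr0.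
have b_comb : 0 *: a + 1 *: b = b by rewrite scale1r scale0r add0r.
have := leftE 1 0; have := leftE 0 1; have := rightE 1 0; have := rightE 0 1.
rewrite a_comb b_comb !mulr1 !mulr0 !addr0 !add0r => -> -> -> ->.
have [||||s t|s t|[p1 z1 r0 q0]|[r1 q1 p0 z0]] :=
  toral_isometry_monomial (p := p) (r := r) (q := q) (u := z)
  (A := hess_coefl F2 (Phi x) * dot (lsubmx (Phi x)) (lsubmx (Phi x)))
  (B := hess_coefr F2 (Phi x) * dot (rsubmx (Phi x)) (rsubmx (Phi x)))
  (a := hess_coefl F1 x * dot (lsubmx x) (lsubmx x))
  (b := hess_coefr F1 x * dot (rsubmx x) (rsubmx x)).
- by rewrite mulr_gt0 ?dot_gt0 ?hess_coefl_gt0 ?ly.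
- by rewrite mulr_gt0 ?dot_gt0 ?hess_coefr_gt0.
- by rewrite mulr_gt0 ?dot_gt0 ?hess_coefl_gt0 ?lx.
- by rewrite mulr_gt0 ?dot_gt0 ?hess_coefr_gt0.
- have := torus_energy s t; rewrite leftE rightE.
  by rewrite !real_normK ?num_real.
- by move=> cl cr; apply/torus_closed; rewrite leftE rightE !cos_norm.
- by left; rewrite r0 q0 normr0 (unit_norm p p1) (unit_norm z z1).
- by right; rewrite p0 z0 normr0 (unit_norm q q1) (unit_norm r r1).
Qed.

End Torus.

Lemma torus_speeds x (v : 'rV[R]_k) (u : 'rV[R]_m) : (1 < k)%N -> C x ->
  sphere_tangent (lsubmx x) v -> v != 0 -> sphere_tangent (rsubmx x) u -> u != 0 ->
  let a := row_mx v 0 *m 'J Phi x in let b := row_mx 0 u *m 'J Phi x in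
  [/\ left_speed (Phi x) a = angular_speed (lsubmx x) v, right_speed (Phi x) a = 0,
      left_speed (Phi x) b = 0 & right_speed (Phi x) b = angular_speed (rsubmx x) u] \/
  [/\ left_speed (Phi x) a = 0, right_speed (Phi x) a = angular_speed (lsubmx x) v,
      left_speed (Phi x) b = angular_speed (rsubmx x) u & right_speed (Phi x) b = 0].
Proof.
move=> k1 Cx tv v0 tu u0 a b; have [/(_ k1) lx rx] := regC Cx.
set p := angular_speed (lsubmx x) v; set q := angular_speed (rsubmx x) u.
have p0 : 0 < p := angular_speed_gt0 lx v0.
have q0 : 0 < q := angular_speed_gt0 rx u0.
have unit_speed n (e w : 'rV[R]_n) r : 0 < r -> angular_speed e w = r ->
    angular_speed e (r^-1 *: w) = 1.
  by move=> r0 wr; rewrite angular_speedZ wr gtr0_norm ?invr_gt0// mulVf// gt_eqF.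
have aE : a = p *: (row_mx (p^-1 *: v) 0 *m 'J Phi x).
  by rewrite scalemxAl scale_row_mx scaler0 scalerA divff ?scale1r// gt_eqF.
have bE : b = q *: (row_mx 0 (q^-1 *: u) *m 'J Phi x).
  by rewrite scalemxAl scale_row_mx scaler0 scalerA divff ?scale1r// gt_eqF.
have := torus_unit_speeds Cx (sphere_tangentZ p^-1 tv) (sphere_tangentZ q^-1 tu)
  (unit_speed _ _ _ _ p0 erefl) (unit_speed _ _ _ _ q0 erefl) k1.
rewrite aE bE !left_speedZ !right_speedZ !(gtr0_norm p0) !(gtr0_norm q0).
by case=> -[-> -> -> ->]; [left|right]; rewrite !mulr0 !mulr1.
Qed.

Definition preserves_factors x :=
  (forall v : 'rV[R]_k, sphere_tangent (lsubmx x) v -> let a := row_mx v 0 *m 'J Phi x in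
     left_speed (Phi x) a = angular_speed (lsubmx x) v /\ right_speed (Phi x) a = 0) /\
  (forall u : 'rV[R]_m, sphere_tangent (rsubmx x) u -> let b := row_mx 0 u *m 'J Phi x in
     left_speed (Phi x) b = 0 /\ right_speed (Phi x) b = angular_speed (rsubmx x) u).

Definition exchanges_factors x :=
  (forall v : 'rV[R]_k, sphere_tangent (lsubmx x) v -> let a := row_mx v 0 *m 'J Phi x in
     left_speed (Phi x) a = 0 /\ right_speed (Phi x) a = angular_speed (lsubmx x) v) /\
  (forall u : 'rV[R]_m, sphere_tangent (rsubmx x) u -> let b := row_mx 0 u *m 'J Phi x in
     left_speed (Phi x) b = angular_speed (rsubmx x) u /\ right_speed (Phi x) b = 0).

Lemma preserves_or_exchanges_factors x : (1 < k)%N -> C x ->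
  preserves_factors x \/ exchanges_factors x.
Proof.
move=> k1 Cx; have [/(_ k1) lx rx] := regC Cx.
have exists_tangent n (e : 'rV[R]_n) : (1 < n)%N -> e != 0 ->
    exists v : 'rV[R]_n, [/\ sphere_tangent e v, v != 0 & angular_speed e v != 0].
  move=> n1 e0; have [v ev nv] := exists_orthogonal e n1.
  have v0 : v != 0 by rewrite -enorm_eq0 nv enorm_eq0.
  by exists v; rewrite gt_eqF ?angular_speed_gt0//; split=> //; exact/sphere_tangentP.
have [v0 [tv0 v0_neq0 sv0]] := exists_tangent _ _ k1 lx.
have [u0 [tu0 u0_neq0 su0]] := exists_tangent _ _ m1 rx.
have [[ls_v0 _ ls_u0 _]|[ls_v0 _ ls_u0 _]] :=
    torus_speeds k1 Cx tv0 v0_neq0 tu0 u0_neq0; [left|right]; split=> w tw /=;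
  have [->|w0] := eqVneq w 0; do ?by rewrite row_mx0 mul0mx left_speed0 right_speed0 angular_speed0.
- have [[]//|[_ _ ls_u0' _]] := torus_speeds k1 Cx tw w0 tu0 u0_neq0.
  by move: su0; rewrite -ls_u0' ls_u0 eqxx.
- have [[]//|[ls_v0' _ _ _]] := torus_speeds k1 Cx tv0 v0_neq0 tw w0.
  by move: sv0; rewrite -ls_v0 ls_v0' eqxx.
- have [[_ _ ls_u0' _]|[]//] := torus_speeds k1 Cx tw w0 tu0 u0_neq0.
  by move: su0; rewrite -ls_u0 ls_u0' eqxx.
have [[ls_v0' _ _ _]|[]//] := torus_speeds k1 Cx tv0 v0_neq0 tw w0.
by move: sv0; rewrite -ls_v0' ls_v0 eqxx.
Qed.

Lemma preserves_factors_dim1 x : k = 1%N -> C x -> preserves_factors x.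
Proof.
move=> k1 Cx; have [_ rx] := regC Cx.
have left0 w : orbit_tangent x w -> left_speed (Phi x) (w *m 'J Phi x) = 0.
  move=> /(orbit_tangent_push Cx)[/(sphere_tangent_dim1 k1) lw0 _].
  by rewrite /left_speed lw0 angular_speed0.
split=> [v /(sphere_tangent_dim1 k1) ->|u tu] /=.
  by rewrite row_mx0 mul0mx left_speed0 right_speed0 angular_speed0.
have [->|u0] := eqVneq u 0.
  by rewrite row_mx0 mul0mx left_speed0 right_speed0 angular_speed0.
split; first exact/left0/orbit_tangent_0row.
pose q := angular_speed (rsubmx x) u; have q0 : 0 < q := angular_speed_gt0 rx u0.
set b := _ *m _; set r := right_speed (Phi x) b.
have r_ge0 : 0 <= r / q by rewrite !divr_ge0 ?enorm_ge0.
suff : r / q = 1 by move=> /(canRL (divfK (lt0r_neq0 q0))); rewrite mul1r.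
apply: cos_frequency_eq1 => // s.
have tsw : orbit_tangent x (row_mx 0 ((s / q) *: u)).
  exact/orbit_tangent_0row/sphere_tangentZ.
have swE : row_mx 0 ((s / q) *: u) = (s / q) *: row_mx 0 u :> V by rewrite scale_row_mx scaler0.
have [] := image_orbit_curve_closed Cx tsw.
rewrite left0// swE -scalemxAl !right_speedZ !left_speedZ -/b -/r.
rewrite /left_speed /right_speed row_mxKl row_mxKr angular_speed0 mulr0 cos0 -/q.
have -> : `|s / q| * q = `|s| by rewrite normrM normfV (gtr0_norm q0) divfK// gt_eqF.
have -> : `|s / q| * r = `|r / q * s|.
  by rewrite [RHS]normrM (ger0_norm r_ge0) normrM normfV (gtr0_norm q0); ring.
by rewrite !cos_norm => rs sr; split=> [/(conj erefl)/rs[]|/(conj erefl)/sr[]].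
Qed.

Lemma preserves_factors_push x w : C x -> preserves_factors x -> orbit_tangent x w ->
  [/\ w *m 'J Phi x = row_mx (lsubmx w *m ulsubmx ('J Phi x)) (rsubmx w *m drsubmx ('J Phi x)),
      left_speed (Phi x) (w *m 'J Phi x) = left_speed x w &
      right_speed (Phi x) (w *m 'J Phi x) = right_speed x w].
Proof.
move=> Cx [sl sr] [tl tr]; rewrite /left_speed /right_speed.
have [_] := orbit_tangent_push Cx (orbit_tangent_row0 tl).
have := sl _ tl; rewrite /= mul_row_mx0r /left_speed /right_speed !row_mxKl !row_mxKr.
move=> [leftE right0] /angular_speed_eq0/(_ right0) ur0.
have [+ _] := orbit_tangent_push Cx (orbit_tangent_0row tr).
have := sr _ tr; rewrite /= mul_row_mx0l /left_speed /right_speed !row_mxKl !row_mxKr.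
move=> [left0 rightE] /angular_speed_eq0/(_ left0) dl0.
by rewrite mul_hsubmx ur0 dl0 addr0 add0r row_mxKl row_mxKr.
Qed.

Lemma exchanges_factors_push x w : C x -> exchanges_factors x -> orbit_tangent x w ->
  [/\ w *m 'J Phi x = row_mx (rsubmx w *m dlsubmx ('J Phi x)) (lsubmx w *m ursubmx ('J Phi x)),
      left_speed (Phi x) (w *m 'J Phi x) = right_speed x w &
      right_speed (Phi x) (w *m 'J Phi x) = left_speed x w].
Proof.
move=> Cx [sl sr] [tl tr]; rewrite /left_speed /right_speed.
have [+ _] := orbit_tangent_push Cx (orbit_tangent_row0 tl).
have := sl _ tl; rewrite /= mul_row_mx0r /left_speed /right_speed !row_mxKl !row_mxKr.
move=> [left0 rightE] /angular_speed_eq0/(_ left0) ul0.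
have [_] := orbit_tangent_push Cx (orbit_tangent_0row tr).
have := sr _ tr; rewrite /= mul_row_mx0l /left_speed /right_speed !row_mxKl !row_mxKr.
move=> [leftE right0] /angular_speed_eq0/(_ right0) dr0.
by rewrite mul_hsubmx ul0 dr0 addr0 add0r row_mxKl row_mxKr.
Qed.

Definition orbit_aligned x P :=
  forall g, block_SO g -> codirectional (Phi (x *m g)) (x *m g *m P).

Lemma orbit_alignedP x P : C x ->
  (forall w, orbit_tangent x w ->
     codirectional (orbit_curve (Phi x) (w *m 'J Phi x) 1) (orbit_curve x w 1 *m P)) ->
  orbit_aligned x P.
Proof.
move=> Cx aligned g /(SO_orbit_curve x)[w tw ->].
by rewrite image_orbit_curve//; exact: aligned.
Qed.

Lemma preserves_factors_aligned x : C x -> preserves_factors x ->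
  exists2 P, block_monomial P & orbit_aligned x P.
Proof.
move=> Cx presx; have [lx rx] := regC Cx; have [ly ry] := regPhi Cx; set J := 'J Phi x.
have [A [oA A1 simA]] : exists A : 'M[R]_k, [/\ A *m A^T = 1%:M, k = 1%N -> A = 1%:M &
    (1 < k)%N -> forall v : 'rV[R]_k, sphere_tangent (lsubmx x) v -> positive_multiple
      (great_circle (lsubmx (Phi x)) (v *m ulsubmx J) 1) (great_circle (lsubmx x) v 1 *m A)].
  have [k1|k1] := ltnP 1 k; last first.
    by exists 1%:M; split=> //; rewrite ?trmx1 ?mulmx1.
  have [v tv|a [A [a0 oA simA]]] :=
      great_circle_similar (e := lsubmx x) (g := lsubmx (Phi x)) (K := ulsubmx J) (lx k1) (ly k1).
    have tw := orbit_tangent_row0 tv; have [tlJ _] := orbit_tangent_push Cx tw.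
    have [pushE speedE _] := preserves_factors_push Cx presx tw.
    by move: tlJ speedE; rewrite /left_speed pushE !row_mxKl.
  by exists A; split=> // [|_ v tv]; [lia|exists a; rewrite ?simA].
have [v tv|b [B [b0 oB simB]]] :=
    great_circle_similar (e := rsubmx x) (g := rsubmx (Phi x)) (K := drsubmx J) rx ry.
  have tw := orbit_tangent_0row tv; have [_ trJ] := orbit_tangent_push Cx tw.
  have [pushE _ speedE] := preserves_factors_push Cx presx tw.
  by move: trJ speedE; rewrite /right_speed pushE !row_mxKr.
exists (block_mx A 0 0 B); first exact: block_monomial_diag.
apply: orbit_alignedP => // w tw; have [-> _ _] := preserves_factors_push Cx presx tw.
rewrite /codirectional mul_block_diag !row_mxKl !row_mxKr.
by case: tw => tl tr; split=> [k1|]; [exact: simA|exists b; rewrite ?simB].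
Qed.

Lemma exchanges_factors_aligned x : (1 < k)%N -> C x -> exchanges_factors x ->
  exists2 P, block_monomial P & orbit_aligned x P.
Proof.
move=> k1 Cx exchx; have [/(_ k1) lx rx] := regC Cx; have [/(_ k1) ly ry] := regPhi Cx.
set J := 'J Phi x.
have [v tv|a [A [a0 oA simA]]] :=
    great_circle_similar (e := lsubmx x) (g := rsubmx (Phi x)) (K := ursubmx J) lx ry.
  have tw := orbit_tangent_row0 tv; have [_ trJ] := orbit_tangent_push Cx tw.
  have [pushE _ speedE] := exchanges_factors_push Cx exchx tw.
  by move: trJ speedE; rewrite /left_speed /right_speed pushE !row_mxKr row_mxKl.
have [v tv|b [B [b0 oB simB]]] :=
    great_circle_similar (e := rsubmx x) (g := lsubmx (Phi x)) (K := dlsubmx J) rx ly.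
  have tw := orbit_tangent_0row tv; have [tlJ _] := orbit_tangent_push Cx tw.
  have [pushE speedE _] := exchanges_factors_push Cx exchx tw.
  by move: tlJ speedE; rewrite /left_speed /right_speed pushE !row_mxKl row_mxKr.
exists (block_mx 0 A B 0); first exact: block_monomial_antidiag.
apply: orbit_alignedP => // w tw; have [-> _ _] := exchanges_factors_push Cx exchx tw.
rewrite /codirectional mul_block_antidiag !row_mxKl !row_mxKr.
by case: tw => tl tr; split=> [_|]; [exists b; rewrite ?simB|exists a; rewrite ?simA].
Qed.

Lemma orbit_alignment x : C x -> exists2 P, block_monomial P & orbit_aligned x P.
Proof.
move=> Cx; have [k1|k1] := ltnP 1 k.
  by have [/(preserves_factors_aligned Cx)|/(exchanges_factors_aligned k1 Cx)] :=
    preserves_or_exchanges_factors k1 Cx.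
by apply: preserves_factors_aligned => //; apply: preserves_factors_dim1 => //; lia.
Qed.

Lemma codirectional_image_meridian x (a b : R) : regular_point x -> a <= b ->
  ((1 < k)%N -> 0 < a) -> (forall s, a <= s <= b -> C (meridian x s)) ->
  codirectional (Phi (meridian x a)) (Phi (meridian x b)).
Proof.
move=> rx ab a0 domC.
pose dG s := row_mx (enorm (rsubmx x) *: axis x) 0 *m 'J Phi (meridian x s).
have dPhi (s : R) : a <= s <= b -> is_derive s 1 (Phi \o meridian x) (dG s).
  move=> sab; have Cs := domC s sab; rewrite /dG -derivePhi//.
  apply: is_derive_comp_differentiable; first exact: is_derive_meridian.
  exact: smooth_on_differentiable sPhi Cs.
have normal_dG s : a <= s <= b -> orbit_normal (Phi (meridian x s)) (dG s).
  move=> sab; apply: orbit_normal_push; first exact: domC.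
  apply: orbit_normal_meridian => // k1; case/andP: sab => sa _.
  exact: lt_le_trans (a0 k1) sa.
split=> [k1|].
  apply: (positive_multiple_radial_curve (G := fun s => lsubmx (Phi (meridian x s)))
    (dG := fun s => lsubmx (dG s)) ab) => s sab.
  have [/(_ k1) ls0 _] := regPhi (domC s sab).
  split=> //; first exact: is_derive_lsubmx (dPhi s sab).
  exact: sphere_normal_collinear ls0 (normal_dG s sab).1.
apply: (positive_multiple_radial_curve (G := fun s => rsubmx (Phi (meridian x s)))
  (dG := fun s => rsubmx (dG s)) ab) => s sab.
have [_ rs0] := regPhi (domC s sab).
split=> //; first exact: is_derive_rsubmx (dPhi s sab).
exact: sphere_normal_collinear rs0 (normal_dG s sab).2.
Qed.

Let conicC (l : R) x : 0 < l -> C x -> C (l *: x).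
Proof. by case: isoPhi => _ [conC _]; exact: conC. Qed.

Let homPhi (l : R) x : 0 < l -> C x -> Phi (l *: x) = l *: Phi x.
Proof. by case: isoPhi => _ [_ [_ [_ [homPhi _]]]]; exact: homPhi. Qed.

Hypothesis connectedC : connected C.

Lemma domain_slope_between x y s : C x -> C y -> slope x <= s <= slope y ->
  exists2 z, C z & slope z = s.
Proof.
move=> Cx Cy; have : connected (slope @` C).
  apply: connected_continuous_connected => //.
  by apply: continuous_in_subspaceT => z /set_mem Cz; exact/slope_continuous/regC.
move=> /connected_intervalP slopeI /(slopeI _ _ _ _)[||z Cz <-]; last by exists z.
  by exists x.
by exists y.
Qed.

Lemma meridian_same_slope x z : regular_point x -> C z ->
  exists a g, [/\ 0 < a, block_SO g & meridian x (slope z) = a *: (z *m g)].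
Proof.
move=> rx Cz; have rz := regC Cz.
have s0 : (1 < k)%N -> 0 < slope z by move=> k1; exact: slope_gt0.
have [||a a0 radii] := @conic_orbit_of_slope _ _ _ z (meridian x (slope z)) rz.
- exact: regular_meridian.
- by rewrite slope_meridian.
have [g bg gE] := orbit_of_same_radii k0 m1 radii.
by exists a, g; rewrite gE scalemxAl.
Qed.

Lemma domain_meridian x z : regular_point x -> C z -> C (meridian x (slope z)).
Proof.
by move=> rx Cz; have [a [g [a0 bg ->]]] := meridian_same_slope rx Cz; exact/conicC/CG.
Qed.

Lemma codirectional_image_same_meridian x z : C x -> C z ->
  codirectional (Phi x) (Phi (meridian x (slope z))).
Proof.
move=> Cx Cz; have rx := regC Cx; rewrite -{1}(meridian_slope rx).
have domC y y' s : C y -> C y' -> slope y <= s <= slope y' -> C (meridian x s).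
  by move=> Cy Cy' /(domain_slope_between Cy Cy')[w Cw <-]; exact: domain_meridian.
have slope_pos y : C y -> (1 < k)%N -> 0 < slope y by move=> /regC ry k1; exact: slope_gt0.
have [xz|/ltW zx] := leP (slope x) (slope z).
  by apply: codirectional_image_meridian => // [|s]; [exact: slope_pos|exact: domC].
apply: codirectional_sym; apply: codirectional_image_meridian => // [|s].
  exact: slope_pos.
exact: domC.
Qed.

Lemma alignment x0 : C x0 ->
  exists2 P, block_monomial P & forall x, C x -> codirectional (Phi x) (x *m P).
Proof.
move=> C0; have [P mP alP] := orbit_alignment C0; exists P => // x Cx; have rx := regC Cx.
apply: codirectional_trans (codirectional_image_same_meridian Cx C0) _.
have [a [g [a0 bg yE]]] := meridian_same_slope rx C0.
have Cg := CG bg C0; rewrite yE homPhi//.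
apply: codirectional_trans (codirectionalZ _ a0) _.
apply: codirectional_trans (alP g bg) _; apply: codirectional_mulmx => //.
apply: codirectional_trans (codirectional_sym (codirectionalZ _ a0)) _; rewrite -yE.
apply: codirectional_meridian => // k1; apply: slope_gt0 => //; exact: regC.
Qed.

End OrbitPreservingIsometry.

(** * Spherical coordinates *)

Section SphericalForm.
Context {R : realType} {k m : nat}.
Local Notation V := 'rV[R]_(k + m).
Implicit Types (x y u v : V).

Lemma sph_tE x : sph_t x = acos (axial x / enorm x).
Proof. by rewrite /sph_t /axial; case: ifP. Qed.

Lemma sph_t_same_radii x y : same_radii x y -> sph_t x = sph_t y.
Proof. by move=> xy; rewrite !sph_tE (same_radii_enorm xy) xy.1. Qed.

Lemma sph_tZ a x : 0 < a -> sph_t (a *: x) = sph_t x.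
Proof.
move=> a0; rewrite !sph_tE axialZ ?ltW// enormZ gtr0_norm// -mulf_div divff ?mul1r//.
by rewrite gt_eqF.
Qed.

Lemma axial_ratio_lt1 x : rsubmx x != 0 -> -1 < axial x / enorm x < 1.
Proof.
move=> rx; have x0 : 0 < enorm x.
  by rewrite enorm_gt0; apply: contraNneq rx => ->; rewrite linear0.
rewrite -ltr_norml -(@expr_lt1 _ 2)// -normrX ger0_norm ?sqr_ge0// expr_div_n.
rewrite ltr_pdivrMr ?exprn_gt0// mul1r enorm_hsubmx_sqr axial_sqr ltrDl.
by rewrite exprn_gt0// enorm_gt0.
Qed.

Lemma cos_sph_t x : rsubmx x != 0 -> enorm x * cos (sph_t x) = axial x.
Proof.
move=> rx; have /andP[lo hi] := axial_ratio_lt1 rx.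
rewrite sph_tE acosK ?in_itv/= ?ltW// mulrC divfK// enorm_eq0.
by apply: contraNneq rx => ->; rewrite linear0.
Qed.

Lemma sin_sph_t x : rsubmx x != 0 -> enorm x * sin (sph_t x) = enorm (rsubmx x).
Proof.
move=> rx; have /andP[lo hi] := axial_ratio_lt1 rx; have ax := cos_sph_t rx.
have sin0 : 0 <= sin (sph_t x).
  by rewrite sph_tE sin_acos ?sqrtr_ge0// !ltW.
apply/eqP; rewrite -(eqrXn2 (n := 2)) ?mulr_ge0 ?enorm_ge0// exprMn sin2cos2 mulrBr mulr1.
by rewrite -exprMn ax axial_sqr enorm_hsubmx_sqr addrAC subrr add0r.
Qed.

Lemma sph_t_itv x : (0 < k)%N -> regular_point x ->
  if k == 1%N then 0 < sph_t x < pi else 0 < sph_t x < pi / 2.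
Proof.
move=> k0 regx; have [lx rx] := regx; have /andP[lo hi] := axial_ratio_lt1 rx.
have t0 : 0 < sph_t x by rewrite sph_tE acos_gt0// hi ltW.
have tpi : sph_t x < pi by rewrite sph_tE acos_ltpi// lo ltW.
rewrite t0 /=; case: eqP => [//|/eqP k_neq1]; have k1 : (1 < k)%N by lia.
have cos_pos : 0 < cos (sph_t x).
  by rewrite -(pmulr_rgt0 _ (_ : 0 < enorm x)) ?cos_sph_t ?axial_gt0// enorm_gt0 regular_point_neq0.
have t_itv : sph_t x \in `[0, pi] by rewrite in_itv /= !ltW.
have pi2_itv : pi / 2 \in `[0, pi : R].
  by rewrite in_itv /=; have := @pi_gt0 R => ?; apply/andP; split; lra.
by rewrite -(ltr_cos t_itv pi2_itv) cos_pihalf.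
Qed.

Lemma same_radii_of_sph_t x y : rsubmx x != 0 -> rsubmx y != 0 ->
  enorm x = enorm y -> sph_t x = sph_t y -> same_radii x y.
Proof.
by move=> rx ry nxy txy; rewrite /same_radii -!cos_sph_t// -!sin_sph_t// nxy txy.
Qed.

Lemma spherical_decomposition x : (0 < k)%N -> rsubmx x != 0 ->
  x = enorm x *: row_mx (cos (sph_t x) *: axis x)
        ((sin (sph_t x) / enorm (rsubmx x)) *: rsubmx x).
Proof.
move=> k0 rx; rewrite scale_row_mx !scalerA mulrA cos_sph_t// sin_sph_t// -axial_axis//.
by rewrite divff ?scale1r ?hsubmxK// enorm_eq0.
Qed.

Lemma codirectional_axis x y : (0 < k)%N -> codirectional x y -> axis x = axis y.
Proof.
move=> k0 [l _]; rewrite /axis; case: eqP => // /eqP k1.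
by apply: positive_multiple_unit; apply: l; lia.
Qed.

Lemma codirectional_regular x y : codirectional x y -> regular_point y -> regular_point x.
Proof.
move=> [l [b b0 rE]] [ly ry]; split=> [k1|]; last by rewrite rE scaler_eq0 negb_or gt_eqF.
by have [a a0 ->] := l k1; rewrite scaler_eq0 negb_or gt_eqF ?ly.
Qed.

Lemma spherical_form_of_codirectional (C : set V) (Psi : V -> V) : (0 < k)%N -> conic C ->
  (forall x, C x -> regular_point x) ->
  (forall (l : R) x, 0 < l -> C x -> Psi (l *: x) = l *: Psi x) ->
  (forall x, C x -> codirectional (Psi x) x) ->
  (forall x y, C x -> C y -> same_radii x y -> same_radii (Psi x) (Psi y)) ->
  spherical_form C Psi.
Proof.
move=> k0 conC regC homPsi codirPsi radiiPsi.
pose point r t := xget (0 : V) [set z | [/\ C z, enorm z = r & sph_t z = t]].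
exists (fun r t => enorm (Psi (point r t))).
exists (fun t => sph_t (Psi (xget 0 [set z | C z /\ sph_t z = t]))) => x Cx r t.
have regPsi : regular_point (Psi x) := codirectional_regular (codirPsi x Cx) (regC x Cx).
have rhoE : enorm (Psi (point r t)) = enorm (Psi x).
  have [Cz nz tz] : [set z | [/\ C z, enorm z = r & sph_t z = t]] (point r t).
    by apply: xgetPex; exists x.
  apply/same_radii_enorm/radiiPsi => //.
  by apply: same_radii_of_sph_t => //; [have [] := regC _ Cz|have [] := regC _ Cx].
have thetaE : sph_t (Psi (xget 0 [set z | C z /\ sph_t z = t])) = sph_t (Psi x).
  set z := xget _ _; have [Cz tz] : [set z | C z /\ sph_t z = t] z.
    by apply: xgetPex; exists x.
  have nz0 : 0 < enorm z by rewrite enorm_gt0; exact/regular_point_neq0/regC.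
  have l0 : 0 < r / enorm z by rewrite divr_gt0// enorm_gt0; exact/regular_point_neq0/regC.
  rewrite -(sph_tZ _ l0) -homPsi//; apply/sph_t_same_radii/radiiPsi => //; first exact: conC.
  apply: same_radii_of_sph_t; [by have [] := regC _ (conC _ _ l0 Cz)|by have [] := regC _ Cx| |].
    by rewrite enormZ gtr0_norm// divfK// gt_eqF.
  by rewrite sph_tZ.
rewrite rhoE thetaE enorm_gt0 regular_point_neq0//; split=> //.
split; first exact: sph_t_itv.
rewrite {1}[Psi x]spherical_decomposition//; last by case: regPsi.
rewrite (codirectional_axis k0 (codirPsi x Cx)) -!scalerA.
rewrite (positive_multiple_unit (codirPsi x Cx).2) !scalerA /axis.
by case: ifP => // _; rewrite scalerA.
Qed.

End SphericalForm.

Section LinearChange.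
Context {R : realType} {k m : nat}.
Local Notation V := 'rV[R]_(k + m).
Implicit Types (F : V -> R) (P : 'M[R]_(k + m)).

Lemma hess_metric_substmx F P x u v :
  hess_metric (fun y => F (y *m P)) x u v = hess_metric F (x *m P) (u *m P) (v *m P).
Proof.
rewrite /hess_metric -derive_substmx; congr ('D_u _ x); apply/funext => y.
exact: (derive_substmx P (energy F)).
Qed.

Lemma mulmx_unit_neq0 P (x : V) : P \in unitmx -> x != 0 -> x *m P != 0.
Proof.
by move=> uP; apply: contra_neq => xP0; rewrite -[x](mulmxK uP) xP0 mul0mx.
Qed.

Lemma minkowski_norm_substmx F P : P \in unitmx -> minkowski_norm F ->
  minkowski_norm (fun x => F (x *m P)).
Proof.
move=> uP [cF [F_ge0 [sF [F_gt0 [homF hessF]]]]].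
have neq0P x : x != 0 -> x *m P != 0 := mulmx_unit_neq0 uP.
split; [|split; [|split; [|split; [|split]]]].
- by move=> x; exact: continuous_comp (@mulmxr_continuous R 1 _ _ P x) (cF _).
- by move=> x; exact: F_ge0.
- by apply: smooth_on_substmx sF _ => x /eqP x0; apply/eqP; exact: neq0P.
- by move=> x /neq0P; exact: F_gt0.
- by move=> l x l0; rewrite -scalemxAl homF.
- by move=> x v /neq0P xP /neq0P vP; rewrite hess_metric_substmx; exact: hessF.
Qed.

Lemma local_hessian_isometry_mulmx (F1 F2 : V -> R) (C : set V) (Phi : V -> V) P :
  P \in unitmx -> local_hessian_isometry F1 F2 C Phi ->
  local_hessian_isometry F1 (fun x => F2 (x *m P)) C (fun x => Phi x *m invmx P).
Proof.
move=> uP [oC [conC [oI [conI [homPhi [[sPhi [psi [spsi [psiK phiK]]]] isoPhi]]]]]].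
have imageE : (fun x => Phi x *m invmx P) @` C = (fun y => y *m P) @^-1` (Phi @` C).
  apply/seteqP; split=> [y [x Cx <-]|y [x Cx xy]] /=; first by exists x; rewrite ?mulmxKV.
  by exists x => //; rewrite xy mulmxK.
split; [exact: oC|split; [exact: conC|split; [|split; [|split; [|split]]]]].
- by rewrite imageE; apply: open_comp oI => y _; exact: (@mulmxr_continuous R 1).
- move=> l y l0 [x Cx <-]; exists (l *: x); first exact: conC.
  by rewrite homPhi// scalemxAl.
- by move=> l x l0 Cx; rewrite homPhi// scalemxAl.
- split.
    exact: (smooth_on_comp_linear (L := mulmxr (invmx P)) oC (@mulmxr_continuous R 1 _ _ _)).
  exists (fun y => psi (y *m P)); split.
    by apply: smooth_on_substmx spsi _ => y; rewrite imageE.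
  split=> [x Cx|y]; first by rewrite mulmxKV// psiK.
  by rewrite imageE /= => /phiK ->; rewrite mulmxK.
move=> x u v Cx.
have deriveE w : 'D_w (fun y => Phi y *m invmx P) x *m P = 'D_w Phi x.
  apply: etrans (mulmxKV uP _); congr (_ *m P).
  exact: (derive_comp_linear (L := mulmxr (invmx P)) _ (@mulmxr_continuous R 1 _ _ _) sPhi Cx).
apply: etrans (hess_metric_substmx _ _ _ _ _) _; apply: etrans (isoPhi x u v Cx).
exact: (f_equal3 (hess_metric F2) (mulmxKV uP _) (deriveE u) (deriveE v)).
Qed.

End LinearChange.

Section Conclusion.
Context {R : realType} {k m : nat}.
Local Notation V := 'rV[R]_(k + m).

Lemma regular_of_disjoint (D : set V) : D `&` @Vprime R k m = set0 ->
  ((1 < k)%N -> D `&` @Vsecond R k m = set0) -> forall x, D x -> regular_point x.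
Proof.
move=> disj1 disj2 x Dx; split=> [/disj2 disj|]; apply/eqP => x0.
  by have : (D `&` @Vsecond R k m) x by []; rewrite disj.
by have : (D `&` @Vprime R k m) x by []; rewrite disj1.
Qed.

Lemma same_radii_image (C : set V) (Phi : V -> V) x y : (0 < k)%N -> (1 < m)%N ->
  maps_orbits_into_orbits C Phi -> C x -> same_radii x y -> same_radii (Phi x) (Phi y).
Proof.
move=> k0 m1 orbitPhi Cx /(orbit_of_same_radii k0 m1)[g bg ->].
have [h [bh ->]] := orbitPhi g x bg Cx.
by have [al re] := same_radii_block_SO (Phi x) bh; split.
Qed.

Lemma aligned_spherical_form (C : set V) (Phi : V -> V) P : (0 < k)%N -> (1 < m)%N ->
  conic C -> (forall x, C x -> regular_point x) ->
  (forall (l : R) x, 0 < l -> C x -> Phi (l *: x) = l *: Phi x) ->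
  maps_orbits_into_orbits C Phi -> block_monomial P ->
  (forall x, C x -> codirectional (Phi x) (x *m P)) ->
  spherical_form C (fun x => Phi x *m invmx P).
Proof.
move=> k0 m1 conC regC homPhi orbitPhi mP alignedP.
have [uP _] := mulmx1_unit mP.1.
have mP' : block_monomial (invmx P).
  by rewrite -[invmx P]mulmx1 -mP.1 mulKmx//; exact: block_monomial_tr.
apply: spherical_form_of_codirectional => // [l x l0 Cx|x Cx|x y Cx Cy xy].
- by rewrite homPhi// scalemxAl.
- by rewrite -{2}[x](mulmxK uP); apply: codirectional_mulmx => //; exact: alignedP.
by apply: same_radii_mulmx => //; exact: same_radii_image orbitPhi Cx xy.
Qed.

End Conclusion.

Theorem theorem3p4 (R : realType) (k m : nat)
  (hn : (3 <= k + m)%N) (hk1 : (1 <= k)%N) (hkm : (k <= m)%N)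
  (F1 F2 : 'rV[R]_(k + m) -> R)
  (hF1 : minkowski_norm F1) (hF2 : minkowski_norm F2)
  (hF1G : G_invariant_fun F1) (hF2G : G_invariant_fun F2)
  (C : set 'rV[R]_(k + m)) (Phi : 'rV[R]_(k + m) -> 'rV[R]_(k + m))
  (hCconn : connected C) (hCG : G_invariant_set C)
  (hCV1 : C `&` @Vprime R k m = set0)
  (hCV2 : (1 < k)%N -> C `&` @Vsecond R k m = set0)
  (hImV1 : (Phi @` C) `&` @Vprime R k m = set0)
  (hImV2 : (1 < k)%N -> (Phi @` C) `&` @Vsecond R k m = set0)
  (hPhi : local_hessian_isometry F1 F2 C Phi)
  (hOrb : maps_orbits_into_orbits C Phi) :
  exists (P : 'M[R]_(k + m)) (Phi2 : 'rV[R]_(k + m) -> 'rV[R]_(k + m)),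
    P \in unitmx /\
    minkowski_norm (fun x => F2 (x *m P)) /\
    local_hessian_isometry F1 (fun x => F2 (x *m P)) C Phi2 /\
    spherical_form C Phi2 /\
    (forall x, C x -> Phi x = Phi2 x *m P).
Proof.
have m1 : (1 < m)%N by lia.
have regC := regular_of_disjoint hCV1 hCV2.
have regPhi x : C x -> regular_point (Phi x).
  by move=> Cx; apply: (regular_of_disjoint hImV1 hImV2); exists x.
have [P mP alignedP] : exists2 P : 'M[R]_(k + m),
    block_monomial P & forall x, C x -> codirectional (Phi x) (x *m P).
  have [C0|/set0P[x0 /(alignment hk1 m1 hF1 hF2 hF1G hF2G hCG hPhi hOrb regC regPhi hCconn)//]] :=
    eqVneq C set0.
  exists (block_mx 1%:M 0 0 1%:M); last by move=> x; rewrite C0.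
  by apply: block_monomial_diag => //; rewrite trmx1 mulmx1.
have [uP _] := mulmx1_unit mP.1.
have [_ [conC [_ [_ [homPhi _]]]]] := hPhi.
exists P, (fun x => Phi x *m invmx P); split; first exact: uP.
split; first exact: minkowski_norm_substmx.
split; first exact: local_hessian_isometry_mulmx.
split; first exact: aligned_spherical_form.
by move=> x _; rewrite mulmxKV.
Qed.
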